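(* Let $X$ be a separable Banach space with norm $\|\cdot\|$ and let $(u_t,\mathbb P_u)$ be a Feller family of Markov processes in $X$ that possesses a mixing extension $(\mathbf u_t,\mathbb P_{\mathbf u})$, with associated exponent $p>1$ and function $g$ (from the coupling hypothesis). Write $\mathbf u_t=(u_t,u_t')$ and $G(\mathbf u)=g(\|u\|)+g(\|u'\|)$ for $\mathbf u=(u,u')\in\mathbf X=X\times X$. Then there exists a random time $\ell\in\mathcal T_+$ such that, for any $0<p_0<p$, there is a constant $C_1>0$, not depending on $\mathbf u$ and $t$, such that for any $\mathbf u\in\mathbf X$, with $\mathbb P_{\mathbf u}$-probability $1$, \[ \|u_t-u_t'\|\le C_1(t-\ell+1)^{-p}\quad\forall t\ge\ell, \] and \[ \mathbb E_{\mathbf u}\,\ell^{p_0}\le C_1(G(\mathbf u)+1). \] If, in addition, there is an increasing function $\tilde g(r)\ge 1$ such that \[ \mathbb E_u\, g(\|u_t\|)\le\tilde g(\|u\|)\quad\forall t\ge0,\ \forall u\in X, \] then the family $(u_t,\mathbb P_u)$ has a unique stationary measure $\mu\in\mathcal P(X)$, and \[ \|P_t(u,\cdot)-\mu\|_L^*\le M(\|u\|)(t+1)^{-p_0}\quad\forall t\ge0,\ u\in X, \] where $M(r)=3C_1(g(r)+\tilde g(0))$.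
   Context: Time set: $\mathcal T=\mathbb R$ or $\mathbb Z$, $\mathcal T_+=\{t\in\mathcal T:t\ge0\}$. $P_t(u,A)=\mathbb P(u_t(u,\omega)\in A)$ is the transition function of the Feller Markov family $(u_t,\mathbb P_u)$; $\mathcal P(X)$ is the set of Borel probability measures on $X$. $\|\mu_1-\mu_2\|_L^*=\sup_{\|f\|_{L(X)}\le1}|\int f\,d\mu_1-\int f\,d\mu_2|$ is the dual-Lipschitz metric, with $\|f\|_{L(X)}=\sup_u|f(u)|+\sup_{u\ne v}\frac{|f(u)-f(v)|}{\|u-v\|}$. Extension: a Markov family $(\mathbf u_t,\mathbb P_{\mathbf u})$ in $X\times X$ is an extension of $(u_t,\mathbb P_u)$ if for any $\mathbf u=(u,u')\in X\times X$ the laws under $\mathbb P_{\mathbf u}$ of $\{\Pi_1\mathbf u_t\}_{t\ge0}$ and $\{\Pi_2\mathbf u_t\}_{t\ge0}$ coincide with those of $\{u_t\}_{t\ge0}$ under $\mathbb P_u$ and $\mathbb P_{u'}$ respectively ($\Pi_1,\Pi_2$ the projections to the components). Coupling hypothesis / mixing extension: an extension $(\mathbf u_t,\mathbb P_{\mathbf u})$ is called a mixing extension if there exist a closed set $B\subset X$ (put $\mathbf B=B\times B$) and an increasing function $g(r)\ge1$ of $r\ge0$ such that the following hold, with $G(\mathbf u)=g(\|u\|)+g(\|u'\|)$. Recurrence: there exists $p>1$ such that $\mathbb E_{\mathbf u}\tau_{\mathbf B}^p\le G(\mathbf u)$ for all $\mathbf u\in\mathbf X$, where $\tau_{\mathbf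 B}=\inf\{t\ge0:\mathbf u_t\in\mathbf B\}$. Polynomial squeezing: with $\sigma=\inf\{t\ge0:\|u_t-u_t'\|\ge C(t+1)^{-p}\}$ ($C>0$ a fixed constant), there exist positive constants $\delta_1,c,K$ and $1\le q\le p$ such that for any $\mathbf u\in\mathbf B$: $\mathbb P_{\mathbf u}(\sigma=\infty)\ge\delta_1$; $\mathbb E_{\mathbf u}(\mathbb I_{\sigma<\infty}\sigma^p)\le c$; $\mathbb E_{\mathbf u}(\mathbb I_{\sigma<\infty}G(\mathbf u_\sigma)^q)\le K$. The underlying space carries a semigroup $\{\theta_t\}_{t\ge0}$ of measure-preserving shifts of $\Omega$ with $\theta_t^{-1}\mathcal F_s\subset\mathcal F_{t+s}$.
   Formalization: For continuous time, the extension is additionally assumed strong Markov with right-continuous paths, and τ_B and σ are assumed to be stopping times; without the strong Markov property the bound on ‖u_t−u_t'‖ can fail. *)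

(* Defs.v *)
(* MathComp-Analysis *)
From mathcomp Require Export all_boot all_order all_algebra.
From mathcomp Require Export all_classical all_reals all_analysis.

Set Implicit Arguments.
Unset Strict Implicit.
Unset Printing Implicit Defensive.

Export Order.TTheory GRing.Theory Num.Theory.
Export numFieldNormedType.Exports.

Local Open Scope classical_set_scope.
Local Open Scope ring_scope.

(* The time set is a subset of the real line, so that discrete and continuous
   time share the same (real) time arithmetic; families indexed by time are
   functions on R of which only the values on [time_plus T] matter. *)
Definition is_time_set (R : realType) (T : set R) : Prop :=
  T = setT \/ T = range (fun k : int => k%:~R).

Definition time_plus (R : realType) (T : set R) : set R :=
  [set t | T t /\ 0 <= t].

Definition separable (X : topologicalType) : Prop :=
  exists D : set X, countable D /\ dense D.

(* For separable X, the product sigma-algebra on [borel X * borel X] used below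
   is the Borel sigma-algebra of X x X. *)
Notation borel X := (g_sigma_algebraType (@open X)).

(* A family of Markov processes: one process [mf_proc] on one filtered space,
   with one probability [mf_law x] for each initial state x. The shifts move
   the initial state, so they do not preserve each P_x; what measure
   preservation means for (P_x) is the case A = setT of [mf_markov]: the image
   of P_x under theta_t is the mixture of the P_y for y distributed as u_t.
   With G = {u_s in B}, [mf_markov] is P_x(u_(t+s) in B | F_t) = P_s(u_t, B). *)
Record markov_family (R : realType) (T : set R)
    d (S : measurableType d) d' (Omega : measurableType d') := MarkovFamily {
  mf_law : R.-pker S ~> Omega ;
  mf_filt : R -> set (set Omega) ;
  mf_shift : R -> Omega -> Omega ;
  mf_proc : R -> Omega -> S ;
  mf_filt_sigma : forall t, time_plus T t -> sigma_algebra setT (mf_filt t) ;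
  mf_filt_sub : forall t, time_plus T t -> mf_filt t `<=` measurable ;
  mf_filt_mono : forall s t, time_plus T s -> time_plus T t -> s <= t ->
    mf_filt s `<=` mf_filt t ;
  mf_shift_measurable : forall t, time_plus T t ->
    measurable_fun setT (mf_shift t) ;
  mf_shift0 : forall w, mf_shift 0 w = w ;
  mf_shiftD : forall s t w, time_plus T s -> time_plus T t ->
    mf_shift (s + t) w = mf_shift s (mf_shift t w) ;
  mf_shift_filt : forall s t A, time_plus T s -> time_plus T t ->
    mf_filt s A -> mf_filt (t + s) (mf_shift t @^-1` A) ;
  mf_proc_shift : forall s t w, time_plus T s -> time_plus T t ->
    mf_proc s (mf_shift t w) = mf_proc (s + t) w ;
  mf_adapted : forall t A, time_plus T t -> measurable A ->
    mf_filt t (mf_proc t @^-1` A) ;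
  mf_start : forall x, {ae mf_law x, forall w, mf_proc 0 w = x} ;
  mf_markov : forall x t A G, time_plus T t -> mf_filt t A -> measurable G ->
    mf_law x (A `&` mf_shift t @^-1` G) =
    (\int[mf_law x]_(w in A) mf_law (mf_proc t w) G)%E }.

Section MarkovFamily.
Context (R : realType) (T : set R).
Context d (S : measurableType d) d' (Omega : measurableType d').
Variable M : markov_family T S Omega.

Definition transition (t : R) (x : S) : set S -> \bar R :=
  pushforward (mf_law M x) (mf_proc M t).

Definition stationary (mu : probability S R) : Prop :=
  forall t A, time_plus T t -> measurable A ->
    (\int[mu]_x transition t x A)%E = mu A.

Definition stopping_time (tau : Omega -> \bar R) : Prop :=
  (forall w, tau w = +oo%E \/ exists2 t, time_plus T t & tau w = t%:E) /\
  (forall t, time_plus T t -> mf_filt M t [set w | (tau w <= t%:E)%E]).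

Definition stopped_events (tau : Omega -> \bar R) : set (set Omega) :=
  [set A | measurable A /\ forall t, time_plus T t ->
    mf_filt M t (A `&` [set w | (tau w <= t%:E)%E])].

Definition strong_markov : Prop :=
  forall tau, stopping_time tau -> forall G, measurable G ->
    let fin := [set w | (tau w < +oo)%E] in
    let future := fin `&` [set w | G (mf_shift M (fine (tau w)) w)] in
    measurable future /\
    forall x A, stopped_events tau A ->
      mf_law M x (A `&` future) =
      (\int[mf_law M x]_(w in A `&` fin)
         mf_law M (mf_proc M (fine (tau w)) w) G)%E.

Definition first_time (H : R -> Omega -> Prop) (w : Omega) : \bar R :=
  ereal_inf [set t%:E | t in [set t | time_plus T t /\ H t w]].

End MarkovFamily.

Definition feller (R : realType) (T : set R) (X : normedModType R)
    d (Omega : measurableType d) (M : markov_family T (borel X) Omega) : Prop :=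
  forall t, time_plus T t -> forall f : X -> R,
    continuous f -> (exists a : R, forall v, `|f v| <= a) ->
    continuous (fun x : X => fine (\int[transition M t x]_v (f v)%:E)%E : R).

(* The pairs with u = v contribute 0 / 0 = 0, which only matters when X is a
   point: it keeps the second supremum from being -oo. *)
Definition lip_norm (R : realType) (X : normedModType R) (f : X -> R) : \bar R :=
  (ereal_sup [set `|f u|%:E | u in [set: X]] +
   ereal_sup [set (`|f uv.1 - f uv.2| / `|uv.1 - uv.2|)%:E
                | uv in [set: X * X]])%E.

Definition dual_lip_dist (R : realType) (X : normedModType R)
    (mu1 mu2 : set (borel X) -> \bar R) : \bar R :=
  ereal_sup [set `|\int[mu1]_u (f u)%:E - \int[mu2]_u (f u)%:E|%E
               | f in [set f : X -> R | (lip_norm f <= 1)%E]].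

(* Product (cylinder) sigma-algebra on the paths t |-> w t, t in T_+. *)
Definition path_sigma (R : realType) (T : set R) d (S : measurableType d) :
    set (set (R -> S)) :=
  <<s [set C | exists t A, [/\ time_plus T t, measurable A &
                              C = [set w : R -> S | A (w t)]] ] >>.

(* g is only required to be defined and monotone on [0, +oo[. *)
Definition weight (R : realType) (g : R -> R) : Prop :=
  (forall r s, 0 <= r -> r <= s -> g r <= g s) /\
  (forall r, 0 <= r -> 1 <= g r).

Section Extension.
Context (R : realType) (T : set R) (X : completeNormedModType R).
Context d (Omega : measurableType d) d' (Omega' : measurableType d').
Variable M : markov_family T (borel X) Omega.
Variable E : markov_family T (borel X * borel X)%type Omega'.

Definition is_extension : Prop :=
  forall (x : X * X) (G : set (R -> borel X)), path_sigma T G ->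
    mf_law E x [set w | G (fun t => (mf_proc E t w).1)] =
    mf_law M x.1 [set w | G (fun t => mf_proc M t w)] /\
    mf_law E x [set w | G (fun t => (mf_proc E t w).2)] =
    mf_law M x.2 [set w | G (fun t => mf_proc M t w)].

Definition pair_dist (t : R) (w : Omega') : R :=
  `|((mf_proc E t w).1 : X) - ((mf_proc E t w).2 : X)|.

Definition pair_weight (g : R -> R) (x : X * X) : R := g `|x.1| + g `|x.2|.

Definition tauB (B : set X) : Omega' -> \bar R :=
  first_time T (fun t w => (B `*` B) (mf_proc E t w)).

Definition sigma (C p : R) : Omega' -> \bar R :=
  first_time T (fun t w => C * (t + 1) `^ (- p) <= pair_dist t w).

Definition recurrence (B : set X) (g : R -> R) (p : R) : Prop :=
  forall x : X * X,
    (\int[mf_law E x]_w (tauB B w `^ p) <= (pair_weight g x)%:E)%E.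

Definition polynomial_squeezing (B : set X) (g : R -> R) (p C : R) : Prop :=
  exists delta1 c K q : R,
  [/\ 0 < delta1, 0 < c, 0 < K, 1 <= q <= p &
  forall x : X * X, (B `*` B) x ->
  [/\ (delta1%:E <= mf_law E x [set w | sigma C p w = +oo])%E,
      (\int[mf_law E x]_(w in [set w | sigma C p w < +oo])
          (sigma C p w `^ p) <= c%:E)%E &
      (\int[mf_law E x]_(w in [set w | sigma C p w < +oo])
          ((pair_weight g (mf_proc E (fine (sigma C p w)) w)) `^ q)%:E
        <= K%:E)%E]].

Definition mixing_extension (B : set X) (g : R -> R) (p C : R) : Prop :=
  [/\ is_extension, closed B /\ weight g, 1 < p /\ 0 < C,
      recurrence B g p & polynomial_squeezing B g p C].

(* What a Markov process in continuous time must satisfy for the hypotheses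
   above to be meaningful (expectations of functions of tau_B and sigma) and
   usable (restarting at tau_B and sigma). For discrete time, paths have no
   regularity and the last three items hold for every Markov family. *)
Definition continuous_time_regular (B : set X) (p C : R) : Prop :=
  [/\ forall w t, 0 <= t ->
        (fun s : R => (mf_proc E s w).1 : X) @ t^'+ --> ((mf_proc E t w).1 : X) /\
        (fun s : R => (mf_proc E s w).2 : X) @ t^'+ --> ((mf_proc E t w).2 : X),
      strong_markov E,
      stopping_time E (tauB B) & stopping_time E (sigma C p)].

End Extension.

(* Main.v *)
(* Restarting the pair process at the hitting time of B x B and running it until
   the squeezing fails, one obtains cycles after each of which the process
   succeeds with probability at least delta; l is the beginning of the first
   cycle that never fails.  The number of cycles is geometric and each cycle has
   a moment of order p, which gives all moments of l of order less than p.

   The coupling bounds |P_t f(u) - P_t f(v)| for Lipschitz f, on {l <= t/2} by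
   the decay of the distance and otherwise by the moments of l.  Replacing v by
   the state at time s of the process issued from 0 shows that P_t(0, .) is
   Cauchy in the dual-Lipschitz metric; comparing P_t(u, .) with P_(t+s)(0, .)
   and letting s tend to infinity, rather than integrating g against the
   stationary measure, avoids any semicontinuity assumption on g.

   The limit of a Cauchy sequence of measures is constructed as the Caratheodory
   measure associated with the limit functional on Lipschitz functions. *)
From HB Require Import structures.
Require Import Defs.
From mathcomp Require Import measurable_realfun ring lra.

Set Implicit Arguments.
Unset Strict Implicit.
Unset Printing Implicit Defensive.

Local Open Scope classical_set_scope.
Local Open Scope ring_scope.

(** * Bounded Lipschitz functions *)

(** The time [l] has to be given before [p0]. It is built from [tauB] and [sigma] alone, and [p0]
    enters only when moments are estimated: on the event that the k-th candidate is reached, its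
    p-th moment stays bounded in k but does not decay, while the probability of this event is
    geometric. Summing over k spends part of this geometric gain, hence the strict inequality
    [p0 < p].

    Two gaps separate Lipschitz test functions from measures. On a space that is not compact, a
    positive functional may lose mass at infinity: separability gives tightness up to finitely many
    balls of a given radius, and completeness turns this into total mass 1. Moreover, the Feller
    property makes [Pt M t f] continuous, not Lipschitz, so stationarity of the limit needs
    convergence for continuous functions, which is recovered from Lipschitz minorants.

    The state at a random time is treated as the initial state of the restarted trajectory, so that
    joint measurability of the process in time and outcome never comes up. *)

Section BoundedLipschitz.
Context (R : realType) (X : completeNormedModType R).
Implicit Types (f g : X -> R) (K : R).

(** One constant bounds both the values and the slope, where [lip_norm] adds the two: maxima and
    minima then keep the constant, and [blip_by 1] contains the test functions of
    [dual_lip_dist]. *)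
Definition blip_by K f :=
  (forall u, `|f u| <= K) /\ (forall u v, `|f u - f v| <= K * `|u - v|).

Definition blip f := exists K, blip_by K f.

Lemma blip_by_ge0 K f : blip_by K f -> 0 <= K.
Proof. by move=> [/(_ 0) fK _]; exact: le_trans fK. Qed.

Lemma blip_byW K K' f : K <= K' -> blip_by K f -> blip_by K' f.
Proof.
move=> KK' [bf lf]; split=> [u|u v]; first exact: le_trans KK'.
by apply: le_trans (lf u v) _; exact: ler_wpM2r.
Qed.

Lemma blip_cst (a : R) : blip (fun=> a).
Proof.
exists `|a|; split=> // u v.
by rewrite subrr normr0 mulr_ge0.
Qed.

Lemma blipD f g : blip f -> blip g -> blip (fun x => f x + g x).
Proof.
move=> [K [bf lf]] [K' [bg lg]]; exists (K + K'); split=> [u|u v].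
  by apply: le_trans (ler_normD _ _) _; exact: lerD.
rewrite opprD addrACA mulrDl.
by apply: le_trans (ler_normD _ _) _; exact: lerD.
Qed.

Lemma blipM f g : blip f -> blip g -> blip (fun x => f x * g x).
Proof.
move=> [K fK] [K' gK]; have K0 := blip_by_ge0 fK; have K'0 := blip_by_ge0 gK.
case: fK gK => bf lf [bg lg]; exists (K * K' + K * K'); split=> [u|u v].
  rewrite normrM; apply: le_trans (ler_pM _ _ (bf u) (bg u)) _ => //.
  by rewrite lerDl mulr_ge0.
have -> : f u * g u - f v * g v = f u * (g u - g v) + (f u - f v) * g v by ring.
apply: le_trans (ler_normD _ _) _; rewrite !normrM mulrDl; apply: lerD.
  by rewrite -mulrA; exact: ler_pM.
have -> : K * K' * `|u - v| = K * `|u - v| * K' by ring.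
exact: ler_pM.
Qed.

Lemma blipZ (a : R) f : blip f -> blip (fun x => a * f x).
Proof. by move=> bf; apply: blipM => //; exact: blip_cst. Qed.

Lemma blipN f : blip f -> blip (fun x => - f x).
Proof.
move=> [K [bf lf]]; exists K; split=> [u|u v]; first by rewrite normrN.
by rewrite -opprD normrN.
Qed.

Lemma blipB f g : blip f -> blip g -> blip (fun x => f x - g x).
Proof. by move=> bf bg; apply: blipD => //; exact: blipN. Qed.

Lemma distr_max (a b c d e : R) : `|a - c| <= e -> `|b - d| <= e ->
  `|Num.max a b - Num.max c d| <= e.
Proof.
rewrite !ler_norml => /andP[h1 h2] /andP[h3 h4].
by have [] := leP a b; have [] := leP c d => *; apply/andP; split; lra.
Qed.

Lemma distr_min (a b c d e : R) : `|a - c| <= e -> `|b - d| <= e ->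
  `|Num.min a b - Num.min c d| <= e.
Proof.
rewrite !ler_norml => /andP[h1 h2] /andP[h3 h4].
by have [] := leP a b; have [] := leP c d => *; apply/andP; split; lra.
Qed.

Lemma blip_by_max K f g : blip_by K f -> blip_by K g ->
  blip_by K (fun x => Num.max (f x) (g x)).
Proof.
move=> [bf lf] [bg lg]; split=> [u|u v]; last exact: distr_max.
by have [] := leP (f u) (g u).
Qed.

Lemma blip_by_min K f g : blip_by K f -> blip_by K g ->
  blip_by K (fun x => Num.min (f x) (g x)).
Proof.
move=> [bf lf] [bg lg]; split=> [u|u v]; last exact: distr_min.
by have [] := leP (f u) (g u).
Qed.

Lemma blip_max f g : blip f -> blip g -> blip (fun x => Num.max (f x) (g x)).
Proof.
move=> [K fK] [K' gK]; exists (Num.max K K').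
by apply: blip_by_max; [apply: blip_byW fK|apply: blip_byW gK];
  rewrite le_max lexx ?orbT.
Qed.

Lemma blip_min f g : blip f -> blip g -> blip (fun x => Num.min (f x) (g x)).
Proof.
move=> [K fK] [K' gK]; exists (Num.max K K').
by apply: blip_by_min; [apply: blip_byW fK|apply: blip_byW gK];
  rewrite le_max lexx ?orbT.
Qed.

Lemma blip_sum (I : Type) (s : seq I) (F : I -> X -> R) :
  (forall k, blip (F k)) -> blip (fun x => \sum_(k <- s) F k x).
Proof.
move=> bF; elim: s => [|i s IHs].
  by under eq_fun do rewrite big_nil; exact: blip_cst.
by under eq_fun do rewrite big_cons /=; exact: blipD.
Qed.

Lemma lipschitz_cts K f : (forall u v, `|f u - f v| <= K * `|u - v|) ->
  continuous f.
Proof.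
move=> lf x; apply/cvgrPdist_lt => e e0.
have K1 : 0 < `|K| + 1 by rewrite ltr_wpDl.
near=> y; apply: le_lt_trans (lf x y) _.
apply: le_lt_trans (_ : (`|K| + 1) * `|x - y| < e).
  by apply: ler_wpM2r => //; apply: le_trans (ler_norm _) _; rewrite lerDl.
rewrite mulrC -ltr_pdivlMr //; near: y.
by apply: (@cvgr_dist_lt _ _ _ (nbhs x) _ id x); rewrite ?divr_gt0//; exact: cvg_id.
Unshelve. all: by end_near. Qed.

Lemma blip_continuous f : blip f -> continuous f.
Proof. by move=> [K [_ lf]]; exact: lipschitz_cts lf. Qed.

Definition bump (d : R) (c x : X) : R := Num.max 0 (1 - `|x - c| / d).

(** A maximum rather than a sum: the bounds 1 and [1 + d^-1] then do not depend on the number of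
    centres, on which [dual_lipschitz_complete] relies. *)
Definition bumps (d : R) (s : seq X) (x : X) : R :=
  \big[Num.max/0]_(c <- s) bump d c x.

Lemma bump_ge0 d c x : 0 <= bump d c x.
Proof. by rewrite /bump le_max lexx. Qed.

Lemma bump_le1 d c x : 0 < d -> bump d c x <= 1.
Proof.
move=> d0; rewrite /bump ge_max ler01 /= lerBlDr lerDl divr_ge0 //.
exact: ltW.
Qed.

Lemma bump_gt0 d c x : 0 < d -> 0 < bump d c x -> `|x - c| < d.
Proof.
by move=> d0; rewrite /bump lt_max ltxx /= subr_gt0 ltr_pdivrMr // mul1r.
Qed.

Lemma bump_blip d c : 0 < d -> blip_by (1 + d^-1) (bump d c).
Proof.
move=> d0; have d'0 : 0 < d^-1 by rewrite invr_gt0.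
split=> [u|u v].
  rewrite ger0_norm ?bump_ge0 //; apply: le_trans (bump_le1 _ _ d0) _.
  by rewrite lerDl ltW.
apply: distr_max; first by rewrite subrr normr0 mulr_ge0 // addr_ge0 // ltW.
have -> : 1 - `|u - c| / d - (1 - `|v - c| / d) = d^-1 * (`|v - c| - `|u - c|).
  by ring.
rewrite normrM gtr0_norm //; apply: ler_pM => //; first exact: ltW.
  by rewrite lerDr.
apply: le_trans (ler_dist_dist _ _) _.
by rewrite opprB addrA subrK distrC.
Qed.

Lemma bumps_ge0 d s x : 0 <= bumps d s x.
Proof.
rewrite /bumps; elim: s => [|c s IHs]; rewrite ?big_nil // big_cons.
by rewrite le_max bump_ge0.
Qed.

Lemma bumps_le1 d s x : 0 < d -> bumps d s x <= 1.
Proof.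
move=> d0; rewrite /bumps; elim: s => [|c s IHs]; rewrite ?big_nil // big_cons.
by rewrite ge_max IHs bump_le1.
Qed.

Lemma bumps_blip d s : 0 < d -> blip_by (1 + d^-1) (bumps d s).
Proof.
move=> d0; elim: s => [|c s [bs ls]].
  have h : 0 <= 1 + d^-1 by rewrite addr_ge0 // invr_ge0 ltW.
  by split=> [u|u v]; rewrite /bumps !big_nil ?subrr normr0 // mulr_ge0.
have [bc lc] := bump_blip c d0.
split=> [u|u v]; rewrite /bumps !big_cons.
  by have [+ _] := blip_by_max (conj bc lc) (conj bs ls); exact.
by apply: distr_max; [exact: lc|exact: ls].
Qed.

Lemma bumps_le_sum d s x : bumps d s x <= \sum_(c <- s) bump d c x.
Proof.
rewrite /bumps; elim: s => [|c s IHs]; rewrite ?big_nil // !big_cons.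
rewrite ge_max lerDl (le_trans IHs) ?lerDr ?bump_ge0 // ?sumr_ge0 // => i _.
exact: bump_ge0.
Qed.

Lemma bumps_ge d s c x : c \in s -> bump d c x <= bumps d s x.
Proof.
rewrite /bumps; elim: s => // a s IHs; rewrite inE big_cons le_max.
by move=> /predU1P[->|/IHs ->]; rewrite ?lexx ?orbT.
Qed.

End BoundedLipschitz.

Lemma Rintegral1 (R : realType) d (T : measurableType d) (P : probability T R)
    (a : R) : \int[P]_x a = a.
Proof.
transitivity (a * fine (P setT)); first exact: Rintegral_cst.
by rewrite probability_setT mulr1.
Qed.

Lemma bounded_integrable (R : realType) d (T : measurableType d)
    (P : probability T R) (f : T -> R) (K : R) :
  measurable_fun setT f -> (forall x, `|f x| <= K) ->
  P.-integrable setT (EFin \o f).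
Proof.
move=> mf fK; apply: measurable_bounded_integrable => //.
  by rewrite -ge0_fin_numE //; exact: fin_num_measure.
exists K; split; first exact: num_real.
by move=> M KM x _; apply: le_trans (fK x) (ltW KM).
Qed.

Section BorelMeasurability.
Context (R : realType) (X : completeNormedModType R).

Lemma borel_open (U : set X) : open U -> (measurable : set (set (borel X))) U.
Proof. exact: sub_sigma_algebra. Qed.

Lemma borel_closed (F : set X) : closed F -> (measurable : set (set (borel X))) F.
Proof.
move=> cF; rewrite -(setCK F); apply: measurableC.
by apply: borel_open; rewrite openC.
Qed.

Lemma borel_continuous (f : X -> R) : continuous f ->
  measurable_fun setT (f : borel X -> R).
Proof.
move=> cf; apply: (measurability _ (@RGenOInfty.measurableE R)).
move=> _ [_ [a ->] <-]; rewrite setTI; apply: borel_open.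
by apply: open_comp => // x _; exact: cf.
Qed.

Lemma blip_measurable (f : X -> R) : blip f ->
  measurable_fun setT (f : borel X -> R).
Proof. by move=> bf; apply: borel_continuous; exact: blip_continuous. Qed.

Lemma blip_integrable (P : probability (borel X) R) (f : X -> R) : blip f ->
  P.-integrable setT (EFin \o (f : borel X -> R)).
Proof.
move=> bf; have mf := blip_measurable bf; have [K [fK _]] := bf.
exact: bounded_integrable mf fK.
Qed.

Section integral.
Variable P : probability (borel X) R.
Implicit Types f g : X -> R.

Lemma blip_RintegralD f g : blip f -> blip g ->
  \int[P]_x (f x + g x) = \int[P]_x f x + \int[P]_x g x.
Proof. by move=> bf bg; apply: RintegralD => //; exact: blip_integrable. Qed.

Lemma blip_RintegralB f g : blip f -> blip g ->
  \int[P]_x (f x - g x) = \int[P]_x f x - \int[P]_x g x.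
Proof. by move=> bf bg; apply: RintegralB => //; exact: blip_integrable. Qed.

Lemma blip_RintegralZ (a : R) f : blip f ->
  \int[P]_x (a * f x) = a * \int[P]_x f x.
Proof. by move=> bf; apply: RintegralZl => //; exact: blip_integrable. Qed.

Lemma blip_le_Rintegral f g : blip f -> blip g -> (forall x, f x <= g x) ->
  \int[P]_x f x <= \int[P]_x g x.
Proof. by move=> bf bg fg; apply: le_Rintegral => //; exact: blip_integrable. Qed.

Lemma blip_Rintegral_sum (F : nat -> X -> R) n : (forall k, blip (F k)) ->
  \int[P]_x (\sum_(k < n) F k x) = \sum_(k < n) \int[P]_x F k x.
Proof.
move=> bF; elim: n => [|n IHn].
  rewrite big_ord0 -[RHS](Rintegral1 P 0).
  by apply: eq_Rintegral => x _; rewrite big_ord0.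
rewrite big_ord_recr /= -IHn -blip_RintegralD //; last exact: blip_sum.
by apply: eq_Rintegral => x _; rewrite big_ord_recr.
Qed.

Lemma blip_integral_fin f : blip f ->
  (\int[P]_x (f x)%:E)%E = (\int[P]_x f x)%:E.
Proof.
by move=> bf; rewrite /Rintegral fineK // integrable_fin_num //; exact: blip_integrable.
Qed.

End integral.
End BorelMeasurability.

(** * Probability measures from positive functionals *)

Section InfConvolution.
Context (R : realType) (X : completeNormedModType R).
Variable h : X -> R.
Hypothesis h01 : forall x, 0 <= h x <= 1.

(** The Pasch-Hausdorff envelope, that is, the largest [m]-Lipschitz minorant of [h]. It exhibits
    indicators of open sets and continuous functions with values in [0, 1] as increasing limits of
    bounded Lipschitz functions. *)
Definition infconv (m : nat) (x : X) : R :=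
  inf [set h y + m%:R * `|x - y| | y in [set: X]].

Let has_inf_infconv m x : has_inf [set h y + m%:R * `|x - y| | y in [set: X]].
Proof.
split; first by exists (h x + m%:R * `|x - x|), x.
exists 0 => _ [y _ <-].
by have /andP[h0 _] := h01 y; rewrite addr_ge0 // mulr_ge0.
Qed.

Lemma infconv_le m x y : infconv m x <= h y + m%:R * `|x - y|.
Proof. by apply: ge_inf; [have [] := has_inf_infconv m x|exists y]. Qed.

Lemma le_infconv m x a : (forall y, a <= h y + m%:R * `|x - y|) ->
  a <= infconv m x.
Proof.
move=> ha; apply: lb_le_inf; first by have [] := has_inf_infconv m x.
by move=> _ [y _ <-].
Qed.

Lemma infconv_le_id m x : infconv m x <= h x.
Proof.
by apply: le_trans (infconv_le m x x) _; rewrite subrr normr0 mulr0 addr0.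
Qed.

Lemma infconv_ge0 m x : 0 <= infconv m x.
Proof.
apply: le_infconv => y.
by have /andP[h0 _] := h01 y; rewrite addr_ge0 // mulr_ge0.
Qed.

Lemma infconv_le1 m x : infconv m x <= 1.
Proof. by apply: le_trans (infconv_le_id _ _) _; have /andP[] := h01 x. Qed.

Lemma infconv_nd m n x : (m <= n)%N -> infconv m x <= infconv n x.
Proof.
move=> mn; apply: le_infconv => y; apply: le_trans (infconv_le m x y) _.
by rewrite lerD2l ler_wpM2r // ler_nat.
Qed.

Lemma infconv_blip m : blip (infconv m).
Proof.
have lip u v : infconv m u <= infconv m v + m%:R * `|u - v|.
  rewrite -lerBlDr; apply: le_infconv => y; rewrite lerBlDr.
  apply: le_trans (infconv_le m u y) _; rewrite -addrA lerD2l -mulrDr.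
  by rewrite ler_wpM2l // -(subrKA v) addrC ler_normD.
exists (1 + m%:R); split=> [u|u v].
  by rewrite ger0_norm ?infconv_ge0 // (le_trans (infconv_le1 _ _)) // lerDl.
apply: le_trans (_ : m%:R * `|u - v| <= _); last first.
  by apply: ler_wpM2r => //; rewrite lerDr.
rewrite ler_norml lerBlDl lip andbT lerNl opprB lerBlDl.
by rewrite distrC lip.
Qed.

(** The hypothesis is lower semicontinuity at [x]. It bounds [h y] within a distance [d] of [x];
    farther away, a penalty of slope at least [d^-1] already exceeds 1, the upper bound of [h]. *)
Lemma infconv_lsc x : (forall e : R, 0 < e -> \forall y \near x, h x - e <= h y) ->
  forall e : R, 0 < e -> exists m, h x - e <= infconv m x.
Proof.
move=> lsc e e0; have /nbhs_ballP[d /= d0 hd] := lsc e e0.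
exists (Num.bound d^-1); apply: le_infconv => y.
have /andP[hy0 _] := h01 y; have /andP[_ hx1] := h01 x.
have [xyd|dxy] := ltP `|x - y| d.
  have hxy : h x - e <= h y by apply: hd; rewrite -ball_normE.
  by rewrite (le_trans hxy) // lerDl mulr_ge0.
have : 1 <= (Num.bound d^-1)%:R * `|x - y|.
  have /ltW db : d^-1 < (Num.bound d^-1)%:R.
    by apply: archi_boundP; rewrite invr_ge0 ltW.
  rewrite -[leLHS](mulVf (lt0r_neq0 d0)).
  by apply: ler_pM => //; rewrite ?invr_ge0 ltW.
by move=> ?; lra.
Qed.

End InfConvolution.

(** * The outer measure of a tight positive functional *)

Section Functional.
Context (R : realType) (X : completeNormedModType R).
Variable L : (X -> R) -> R.
Hypothesis LD : forall f g, blip f -> blip g ->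
  L (fun x => f x + g x) = L f + L g.
Hypothesis LZ : forall a f, blip f -> L (fun x => a * f x) = a * L f.
Hypothesis Lmono : forall f g, blip f -> blip g -> (forall x, f x <= g x) ->
  L f <= L g.
Hypothesis L1 : L (fun=> 1) = 1.
(* Tightness up to balls of radius [d], with the indicator function of the
   neighbourhood of a finite set [s] replaced by [bumps d s]. *)
Hypothesis Ltight : forall e d : R, 0 < e -> 0 < d ->
  exists s, 1 - e <= L (bumps d s).

Let L0 : L (fun=> 0) = 0.
Proof.
rewrite -[RHS](mul0r (L (fun=> 1))) -LZ; last exact: blip_cst.
by congr L; apply/funext => x; rewrite mul0r.
Qed.

Let LB f g : blip f -> blip g -> L (fun x => f x - g x) = L f - L g.
Proof.
move=> bf bg; rewrite LD //; last exact: blipN.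
congr (_ + _); rewrite -mulN1r -LZ //.
by congr L; apply/funext => x; rewrite mulN1r.
Qed.

Let L_ge0 f : blip f -> (forall x, 0 <= f x) -> 0 <= L f.
Proof. by move=> bf f0; rewrite -L0; apply: Lmono => //; exact: blip_cst. Qed.

Let L_sum (I : Type) (s : seq I) (F : I -> X -> R) :
  (forall k, blip (F k)) ->
  L (fun x => \sum_(k <- s) F k x) = \sum_(k <- s) L (F k).
Proof.
move=> bF; elim: s => [|i s IHs].
  by rewrite big_nil -[RHS]L0; congr L; apply/funext => x; rewrite big_nil.
rewrite big_cons -IHs -LD //; last exact: blip_sum.
by congr L; apply/funext => x; rewrite big_cons.
Qed.

(* A is covered, at cost c, by an increasing sequence of functions: this avoids
   the double series that countable covers by sets or functions require. *)
Definition lcover (A : set X) (c : R) := exists F : nat -> X -> R,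
  [/\ forall n, blip (F n), forall n x, 0 <= F n x,
      forall m n x, (m <= n)%N -> F m x <= F n x, forall n, L (F n) <= c &
      forall x, A x -> forall e : R, 0 < e -> exists n, 1 - e <= F n x].

Definition mstar (A : set X) : \bar R := ereal_inf [set c%:E | c in lcover A].

Lemma lcover_ge0 A c : lcover A c -> 0 <= c.
Proof. by move=> [F [bF F0 _ Fc _]]; apply: le_trans (Fc 0%N); exact: L_ge0. Qed.

Lemma lcover1 A : lcover A 1.
Proof.
exists (fun=> fun=> 1); split=> //; last first.
  by move=> x _ e e0; exists 0%N; rewrite gerBl ltW.
- by rewrite L1.
- by move=> _; exact: blip_cst.
Qed.

Lemma mstar_ge0 A : (0 <= mstar A)%E.
Proof. by apply: le_ereal_inf_tmp => _ [c Ac <-]; rewrite lee_fin (lcover_ge0 Ac). Qed.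

Lemma mstar_le c A : lcover A c -> (mstar A <= c%:E)%E.
Proof. by move=> Ac; apply: ereal_inf_lbound; exists c. Qed.

Lemma mstar_le1 A : (mstar A <= 1)%E.
Proof. exact/mstar_le/lcover1. Qed.

Lemma mstar_fin A : mstar A \is a fin_num.
Proof.
by rewrite ge0_fin_numE ?mstar_ge0 // (le_lt_trans (mstar_le1 A)) // ltry.
Qed.

Lemma mstar_adherent A (e : R) : 0 < e ->
  exists2 c, lcover A c & (c%:E < mstar A + e%:E)%E.
Proof.
move=> e0; have [_ [c Ac <-] ce] := lb_ereal_inf_adherent e0 (mstar_fin A).
by exists c.
Qed.

Lemma mstar0 : mstar set0 = 0%E.
Proof.
apply/eqP; rewrite eq_le mstar_ge0 andbT; apply: mstar_le.
exists (fun=> fun=> 0); split=> //; first by move=> _; exact: blip_cst.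
by rewrite L0.
Qed.

Lemma le_mstar : {homo mstar : A B / A `<=` B >-> (A <= B)%E}.
Proof.
move=> A B AB; apply: ereal_inf_le_tmp => _ [c [F [? ? ? ? BF]] <-].
by exists c => //; exists F; split=> // x /AB; exact: BF.
Qed.

(** Nearly optimal covers of the [A n] are added along a diagonal: the [n]-th function sums the
    first [n] covers, each taken at stage [n]. It increases because terms are both added and
    enlarged, and its cost is at most the series with errors e / 2^(n+1). *)
Lemma mstar_sigma_subadditive : sigma_subadditive mstar.
Proof.
move=> A; apply/lee_addgt0Pr => e e0.
have h n : {cF : R * (nat -> X -> R) |
  [/\ forall k, blip (cF.2 k), forall k x, 0 <= cF.2 k x,
      forall i j x, (i <= j)%N -> cF.2 i x <= cF.2 j x,
      forall k, L (cF.2 k) <= cF.1 &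
      forall x, A n x -> forall e : R, 0 < e -> exists k, 1 - e <= cF.2 k x] /\
  (cF.1%:E <= mstar (A n) + (e / (2 ^ n.+1)%:R)%:E)%E}.
  apply/cid; have en : 0 < e / (2 ^ n.+1)%:R.
    by rewrite divr_gt0 // ltr0n expn_gt0.
  have [c [F AF] /ltW ce] := mstar_adherent (A n) en.
  by exists (c, F).
pose c n := (sval (h n)).1; pose F n := (sval (h n)).2.
have hF n := (svalP (h n)).1; have hc n := (svalP (h n)).2.
have bF n k : blip (F n k) by have [+ _ _ _ _] := hF n; exact.
have F0 n k x : 0 <= F n k x by have [_ + _ _ _] := hF n; exact.
have Fc n k : L (F n k) <= c n by have [_ _ _ + _] := hF n; exact.
apply: le_trans (epsilon_trick _ _ (ltW e0)); last by move=> n; exact: mstar_ge0.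
set S := (\sum_(_ <oo) _)%E.
have [->|Soo] := eqVneq S +oo%E; first exact: leey.
have cS n : ((\sum_(k < n) c k)%:E <= S)%E.
  rewrite -sumEFin; apply: le_trans (_ : (\sum_(k < n)
      (mstar (A k) + (e / (2 ^ k.+1)%:R)%:E) <= _)%E).
    by apply: lee_sum => k _; exact: hc.
  rewrite /S -(big_mkord xpredT (fun k => mstar (A k) + (e / (2 ^ k.+1)%:R)%:E)%E).
  apply: nneseries_lim_ge => k _; rewrite adde_ge0 ?mstar_ge0 // lee_fin.
  by rewrite divr_ge0 // ltW.
have S0 : (0 <= S)%E by have := cS 0%N; rewrite big_ord0.
have Sfin : S \is a fin_num by rewrite ge0_fin_numE // ltey.
rewrite -(fineK Sfin); apply: mstar_le.
exists (fun n x => \sum_(k <- iota 0 n) F k n x); split.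
- by move=> n; exact: blip_sum.
- by move=> n x; exact: sumr_ge0.
- move=> m n x mn; rewrite -(subnKC mn) iotaD big_cat /=.
  apply: le_trans (_ : \sum_(k <- iota 0 m) F k (m + (n - m))%N x <= _); last first.
    by rewrite lerDl sumr_ge0.
  by apply: ler_sum => k _; have [_ _ + _ _] := hF k; apply; exact: leq_addr.
- move=> n; rewrite L_sum //.
  rewrite -lee_fin fineK //; apply: le_trans (cS n).
  rewrite lee_fin -(big_mkord xpredT c) /index_iota subn0.
  by apply: ler_sum => k _; exact: Fc.
- move=> x [j _ Ajx] d d0; have [_ _ Fnd _ /(_ x Ajx d d0)[k dk]] := hF j.
  exists (maxn k j.+1); apply: le_trans dk _.
  apply: le_trans (Fnd k (maxn k j.+1) x (leq_maxl _ _)) _.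
  rewrite (big_rem j) /=; last by rewrite mem_iota add0n leq_max ltnS leqnn orbT.
  by rewrite lerDl sumr_ge0.
Qed.

HB.instance Definition _ := isOuterMeasure.Build R X mstar mstar0 mstar_ge0
  le_mstar mstar_sigma_subadditive.

(** The envelopes [phi n] of the indicator of [U] increase to 1 on [U] and vanish outside. They
    split a nearly optimal cover [F] of [A]: [F n * phi n] covers the part in [U], and
    [F (m + n) * (1 - phi m)], with [m] frozen, covers the rest. *)
Lemma open_mstar_caratheodory (U : set X) : open U -> mstar.-caratheodory U.
Proof.
move=> oU; apply: le_caratheodory_measurable => A.
pose h : X -> R := \1_U.
have h01 x : 0 <= h x <= 1 by rewrite /h indicE; case: (x \in U); rewrite !lexx ler01.
have hU x : U x -> h x = 1 by move=> Ux; rewrite /h indicE mem_set.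
have hUC x : ~ U x -> h x = 0 by move=> Ux; rewrite /h indicE memNset.
have lsc x : U x -> forall e : R, 0 < e -> exists m, 1 - e <= infconv h m x.
  move=> Ux e e0; rewrite -(hU x Ux); apply: (infconv_lsc h01) => // d d0.
  have : \forall y \near x, U y by exact: open_nbhs_nbhs.
  by apply: filterS => y Uy; rewrite !hU // gerBl ltW.
pose phi m := infconv h m.
have bphi m : blip (phi m) by exact: infconv_blip.
have bphiC m : blip (fun x => 1 - phi m x) by apply: blipB => //; exact: blip_cst.
have phi0 m x : 0 <= phi m x by exact: infconv_ge0.
have phi1 m x : 0 <= 1 - phi m x by rewrite subr_ge0; exact: infconv_le1.
have phind m n x : (m <= n)%N -> phi m x <= phi n x by exact: infconv_nd.
apply/lee_addgt0Pr => e e0; have e20 : 0 < e / 2 by rewrite divr_gt0.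
have [c [F [bF F0 Fnd Fc AF]] cA] := mstar_adherent A e20.
have bFphi n m : blip (fun x => F n x * phi m x) by exact: blipM.
pose b n := L (fun x => F n x * phi n x).
have b_nd m n : (m <= n)%N -> b m <= b n.
  by move=> mn; apply: Lmono => // x; apply: ler_pM => //; [exact: Fnd|exact: phind].
have bc n : b n <= c.
  apply: le_trans (Fc n); apply: Lmono => // x; rewrite ler_piMr //.
  exact: infconv_le1.
pose bs := sup (range b).
have hsb : has_sup (range b).
  by split; [exists (b 0%N), 0%N|exists c => _ [n _ <-]].
have [_ [m _ <-] bm] := sup_adherent e20 hsb; rewrite -/bs in bm.
have covU : lcover (A `&` U) bs.
  exists (fun n x => F n x * phi n x); split=> //.
  - by move=> n x; rewrite mulr_ge0.
  - by move=> i j x ij; apply: ler_pM => //; [exact: Fnd|exact: phind].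
  - by move=> n; apply: ub_le_sup; [have [] := hsb|exists n].
  - move=> x [Ax Ux] d d0.
    have [d1|d1] := lerP 1 d.
      by exists 0%N; rewrite (@le_trans _ _ 0) ?subr_le0 // mulr_ge0.
    have d20 : 0 < d / 2 by rewrite divr_gt0.
    have [i Fi] := AF x Ax _ d20; have [j phij] := lsc x Ux _ d20.
    exists (maxn i j).
    apply: le_trans (_ : (1 - d / 2) * (1 - d / 2) <= _); first by nra.
    apply: ler_pM; [lra|lra| |].
      by apply: le_trans Fi _; apply: Fnd; exact: leq_maxl.
    by apply: le_trans phij _; apply: phind; exact: leq_maxr.
(* The index [m] is one at which the increasing costs [b] are within [e / 2] of their supremum.
   Since [F (m + n)] dominates [F m], at least [b m] is subtracted from the cost [c]. *)
have covUC : lcover (A `&` ~` U) (c - (bs - e / 2)).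
  exists (fun n x => F (m + n)%N x * (1 - phi m x)); split=> //.
  - by move=> n; exact: blipM.
  - by move=> n x; rewrite mulr_ge0.
  - by move=> i j x ij; apply: ler_wpM2r => //; apply: Fnd; rewrite leq_add2l.
  - move=> n.
    under eq_fun do rewrite mulrBr mulr1.
    rewrite LB //; apply: lerB; first exact: Fc.
    apply: le_trans (ltW bm) _; apply: Lmono => // x.
    by apply: ler_wpM2r => //; apply: Fnd; exact: leq_addr.
  - move=> x [Ax Ux] d d0; have [i Fi] := AF x Ax d d0; exists i.
    have -> : phi m x = 0.
      by apply/eqP; rewrite eq_le phi0 andbT -(hUC x Ux); exact: infconv_le_id.
    by rewrite subr0 mulr1; apply: le_trans Fi _; apply: Fnd; exact: leq_addl.
apply: le_trans (leeD (mstar_le covU) (mstar_le covUC)) _.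
rewrite -EFinD; have -> : bs + (c - (bs - e / 2)) = c + e / 2 by ring.
rewrite EFinD.
apply: le_trans (leeD2r _ (ltW cA)) _.
by rewrite -addeA -EFinD -splitr.
Qed.


(** Below, [psi n] decreases with [n]; the bound [b] says that its mass seen through the
    localization [G] does not vanish in the limit. *)
Let Pos (G : X -> R) (psi : nat -> X -> R) := [/\ blip G, forall x, 0 <= G x <= 1 &
  exists2 b : R, 0 < b & forall n, b <= L (fun x => psi n x * G x)].

Let Pos_bump psi G (d : R) : (forall n, blip (psi n)) ->
    (forall n x, 0 <= psi n x <= 1) ->
    (forall m n x, (m <= n)%N -> psi n x <= psi m x) ->
  0 < d -> Pos G psi -> exists c, Pos (fun x => G x * bump d c x) psi.
Proof.
move=> bpsi psi01 psind d0 [bG G01 [b b0 hb]].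
have bb (c : X) : blip (bump d c) by eexists; exact: bump_blip.
have bG' c : blip (fun x => G x * bump d c x) by exact: blipM.
apply: contrapT => /forallNP noc.
have b20 : 0 < b / 2 by rewrite divr_gt0.
have [s hs] := Ltight b20 d0.
have bs : blip (bumps d s) by eexists; exact: bumps_blip.
have [b' b'0 b'E] : exists2 b', 0 < b' & (size s)%:R * b' < b / 2.
  exists (b / 2 / (size s).+1%:R); first by rewrite divr_gt0.
  by rewrite mulrCA gtr_pMr // ltr_pdivrMr // mul1r ltr_nat.
have small c : exists n, L (fun x => psi n x * (G x * bump d c x)) < b'.
  apply: contrapT => /forallNP h; apply: (noc c); split=> //.
    move=> x; have /andP[? ?] := G01 x.
    by rewrite mulr_ge0 ?bump_ge0 //= mulr_ile1 ?bump_ge0 ?bump_le1.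
  by exists b' => // n; have /negP := h n; rewrite -leNgt.
have {small}[N smallN] : exists N, forall c, c \in s ->
    L (fun x => psi N x * (G x * bump d c x)) < b'.
  clear b'E hs bs.
  elim: s => [|c s [N hN]]; first by exists 0%N.
  have [n hn] := small c.
  exists (maxn N n) => c'; rewrite inE => /predU1P[->|/hN].
    apply: le_lt_trans hn; apply: Lmono => [||x]; [exact: blipM|exact: blipM|].
    apply: ler_wpM2r; last by apply: psind; exact: leq_maxr.
    by rewrite mulr_ge0 ?bump_ge0 //; have /andP[] := G01 x.
  apply: le_lt_trans; apply: Lmono => [||x]; [exact: blipM|exact: blipM|].
  apply: ler_wpM2r; last by apply: psind; exact: leq_maxl.
  by rewrite mulr_ge0 ?bump_ge0 //; have /andP[] := G01 x.
have bpG : blip (fun x => psi N x * G x) by exact: blipM.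
have bpGs : blip (fun x => psi N x * G x * bumps d s x) by exact: blipM.
have pG01 x : 0 <= psi N x * G x <= 1.
  have /andP[? ?] := G01 x; have /andP[? ?] := psi01 N x.
  by rewrite mulr_ge0 //= mulr_ile1.
have : L (fun x => psi N x * G x) - L (fun x => psi N x * G x * bumps d s x)
    <= b / 2.
  rewrite -LB //.
  apply: le_trans (_ : L (fun x => 1 - bumps d s x) <= _).
    apply: Lmono => [||x]; [exact: blipB|apply: blipB => //; exact: blip_cst|].
    have -> : psi N x * G x - psi N x * G x * bumps d s x =
      (psi N x * G x) * (1 - bumps d s x) by ring.
    have /andP[? ?] := pG01 x.
    by rewrite ler_piMl // subr_ge0 bumps_le1.
  rewrite LB // ?L1; first by lra.
  exact: blip_cst.
have : L (fun x => psi N x * G x * bumps d s x) <= (size s)%:R * b'.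
  apply: le_trans (_ : L (fun x => \sum_(c <- s) psi N x * (G x * bump d c x)) <= _).
    apply: Lmono => [||x] //; first by apply: blip_sum => c; exact: blipM.
    under eq_bigr do rewrite mulrA.
    have /andP[? ?] := pG01 x.
    by rewrite -mulr_sumr ler_wpM2l // bumps_le_sum.
  rewrite L_sum; last by move=> c; exact: blipM.
  apply: le_trans (_ : \sum_(c <- s) b' <= _).
    by rewrite !big_seq; apply: ler_sum => c cs; exact/ltW/smallN.
  by rewrite big_const_seq count_predT iter_addr_0 mulr_natl.
have := hb N.
move: (L _) (L _) => u v *; lra.
Qed.

(* Otherwise one can choose nested balls with radii tending to 0 such that the
   n-th one contains a point where [F n < 1 - e]; by completeness they shrink to
   a point that is not covered. *)
Lemma lcoverT_ge1 c : lcover setT c -> 1 <= c.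
Proof.
move=> [F [bF F0 Fnd Fc AF]]; rewrite leNgt; apply/negP => c1.
(* The function [psi n] is positive exactly where [F n] is below [1 - e], and its value under [L] is
   at least 1 - e - c = e for every [n]. *)
pose e := (1 - c) / 2; have e0 : 0 < e by rewrite /e; lra.
pose psi n x := Num.max 0 (1 - e - F n x).
have c0 : 0 <= c by apply: le_trans (Fc 0%N); exact: L_ge0.
have bpsi' n : blip (fun x => 1 - e - F n x).
  by apply: blipB => //; exact: blip_cst.
have bpsi n : blip (psi n) by apply: blip_max => //; exact: blip_cst.
have psi01 n x : 0 <= psi n x <= 1.
  rewrite /psi le_max lexx /= ge_max ler01 /=.
  by have := F0 n x; rewrite /e; lra.
have psind m n x : (m <= n)%N -> psi n x <= psi m x.
  move=> mn; rewrite /psi ge_max !le_max lexx /=; apply/orP; right.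
  by rewrite lerD2l lerN2; exact: Fnd.
pose T := {G | Pos G psi}.
have P1 : Pos (fun=> 1) psi.
  split=> [|x|]; [exact: blip_cst|by rewrite ler01 lexx|].
  exists e => // n; under eq_fun do rewrite mulr1.
  apply: le_trans (_ : L (fun x => 1 - e - F n x) <= _).
    rewrite LB //; last exact: blip_cst.
    have -> : L (fun=> 1 - e) = 1 - e.
      rewrite -[RHS]mulr1 -L1 -LZ; last exact: blip_cst.
      by congr L; apply/funext => x; rewrite mulr1.
    by have := Fc n; rewrite /e; lra.
  by apply: Lmono => // x; rewrite /psi le_max lexx orbT.
have pw n : 0 < 2^-1 ^+ n :> R by rewrite exprn_gt0.
have st (n : nat) (G : T) :
    {c | Pos (fun x => sval G x * bump (2^-1 ^+ n) c x) psi}.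
  by apply/cid; apply: Pos_bump => //; exact: (svalP G).
(* [Gs n] is a product of [n] bumps of radii 2^(-i). Carrying the proof of [Pos] along allows the
   next centre to be chosen, and a point where the product is positive lies in all the balls so
   far. *)
pose Gs := nat_rect (fun=> T) (exist (fun G => Pos G psi) _ P1)
  (fun n G => exist (fun G => Pos G psi) _ (svalP (st n G))).
pose a n := sval (st n (Gs n)).
have GsP n x : 0 < sval (Gs n) x ->
    forall i, (i < n)%N -> `|x - a i| < 2^-1 ^+ i.
  elim: n => // n IHn /= Gx i; rewrite ltnS leq_eqVlt => /predU1P[->|].
    apply: bump_gt0 => //; rewrite lt0r bump_ge0 andbT.
    by apply/eqP => h; move: Gx; rewrite h mulr0 ltxx.
  move=> ni; apply: IHn => //; have [_ /(_ x)/andP[h _] _] := svalP (Gs n).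
  rewrite lt0r h andbT; apply/eqP => h'; move: Gx; rewrite h' mul0r ltxx //.
have hy j : {y | F j y < 1 - e /\ forall i, (i < j)%N -> `|y - a i| < 2^-1 ^+ i}.
  apply/cid; have [bG G01 [b b0 /(_ j) hb]] := svalP (Gs j).
  apply: contrapT => /forallNP h.
  suff : L (fun x => psi j x * sval (Gs j) x) <= 0.
    by move=> /(le_trans hb); rewrite leNgt b0.
  rewrite -L0; apply: Lmono => [||x]; [exact: blipM|exact: blip_cst|].
  rewrite leNgt; apply/negP => pG.
  have [h1 _] := andP (psi01 j x); have [h2 _] := andP (G01 x).
  apply: (h x); split.
    have : 0 < psi j x.
      by rewrite lt0r h1 andbT; apply/eqP => h'; rewrite h' mul0r ltxx in pG.
    by rewrite /psi lt_max ltxx /= subr_gt0.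
  apply: GsP; rewrite lt0r h2 andbT.
  by apply/eqP => h'; rewrite h' mulr0 ltxx in pG.
pose y j := sval (hy j).
have yP j := svalP (hy j).
have cy : cvg (y @ \oo).
  apply/cauchy_cvgP/cauchyP => d d0.
  have [i hi] : exists i, 2^-1 ^+ i < d.
    have /cvgrPdist_lt/(_ _ d0) : (fun n => 2^-1 ^+ n : R) @ \oo --> 0.
      by apply: cvg_expr; rewrite gtr0_norm ?invf_lt1 ?ltr1n.
    by case=> N _ /(_ N (leqnn N)); rewrite /= sub0r normrN gtr0_norm // => ?; exists N.
  exists (a i).
  exists i.+1 => // j /= ij; rewrite -ball_normE /= distrC.
  by apply: lt_trans hi; have [_] := yP j; apply.
(* At the limit point the cover gives [F n] at least [1 - e / 2] for some [n], whereas
   [F n (y j) <= F j (y j) < 1 - e] for all [j >= n] gives at most [1 - e] in the limit. *)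
have [n hn] := AF (lim (y @ \oo)) I (e / 2) ltac:(lra).
have cF : F n (y j) @[j --> \oo] --> F n (lim (y @ \oo)).
  by apply: continuous_cvg => //; apply: blip_continuous.
have : F n (lim (y @ \oo)) <= 1 - e.
  apply: (cvgr_to_le cF).
  exists n => // j /= nj; apply: le_trans (ltW (yP j).1); exact: Fnd.
lra.
Qed.

Lemma mstarT : mstar setT = 1%E.
Proof.
apply/eqP; rewrite eq_le mstar_le1 /=.
by apply: le_ereal_inf_tmp => _ [c /lcoverT_ge1 c1 <-]; rewrite lee_fin.
Qed.

Let sum_minS (N : nat) (y : R) : 0 <= y ->
  \sum_(k < N) (Num.min y k.+1%:R - Num.min y k%:R) = Num.min y N%:R.
Proof.
move=> y0; elim: N => [|N IHN]; first by rewrite big_ord0 min_r.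
by rewrite big_ord_recr /= IHN addrC subrK.
Qed.

(** A layer-cake argument: [N * f] is cut into [N] horizontal layers [F k] of height 1. The layer
    [F k] equals 1 on [A k], so the constant sequence covers [A k] at cost [L (F k)]; the next layer
    is supported in [A k], so its integral is at most [mu (A k)]. *)
Lemma integral_mstar_le (mu : probability (borel X) R) (f : X -> R) :
  (forall A : set X, mu A = mstar A) -> blip f -> (forall x, 0 <= f x <= 1) ->
  \int[mu]_x f x <= L f.
Proof.
move=> muE bf f01; apply/ler_addgt0Pr => e e0.
pose N := Num.bound e^-1.
have N0 : 0 < N%:R :> R.
  by apply: lt_trans (archi_boundP _); rewrite ?invr_gt0 // invr_ge0 ltW.
have Ne : 1 <= N%:R * e.
  by rewrite -ler_pdivrMr // div1r ltW // archi_boundP // invr_ge0 ltW.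
pose F k x := Num.min (N%:R * f x) k.+1%:R - Num.min (N%:R * f x) k%:R.
have bNf : blip (fun x => N%:R * f x) by exact: blipZ.
have bF k : blip (F k) by apply: blipB; apply: blip_min => //; exact: blip_cst.
have kS k : k%:R <= k.+1%:R :> R by rewrite ler_nat.
have F0 k x : 0 <= F k x.
  by rewrite subr_ge0 le_min ge_min lexx /= ge_min kS orbT.
have F1 k x : F k x <= 1.
  rewrite /F -natr1.
  by case: (leP _ k%:R) => ?; case: (leP _ (k%:R + 1)) => ?; lra.
have Nf0 x : 0 <= N%:R * f x by have /andP[? _] := f01 x; rewrite mulr_ge0 // ltW.
have sumF x : \sum_(k < N) F k x = N%:R * f x.
  rewrite sum_minS // min_l //.
  by have /andP[_ ?] := f01 x; rewrite -[leRHS]mulr1 ler_wpM2l // ltW.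
pose A k := [set x | k.+1%:R <= N%:R * f x].
have mA k : (measurable : set (set (borel X))) (A k).
  have := blip_measurable bNf measurableT (measurable_itv `[k.+1%:R, +oo[).
  rewrite setTI; congr measurable.
  by apply/seteqP; split=> x; rewrite /A /= in_itv /= andbT.
have FA k x : A k x -> F k x = 1.
  rewrite /A /= /F => Akx; rewrite min_r // min_r; last exact: le_trans Akx.
  by rewrite -natr1 addrC addKr.
have AL k : fine (mu (A k)) <= L (F k).
  rewrite -lee_fin fineK; last by rewrite muE mstar_fin.
  rewrite muE; apply: mstar_le; exists (fun=> F k); split=> // x Ax d d0.
  by exists 0%N; rewrite FA // gerBl ltW.
have FAS k : \int[mu]_x F k.+1 x <= fine (mu (A k)).
  rewrite -[leRHS]mul1r -Rintegral_cst // [leRHS]Rintegral_mkcond.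
  apply: le_Rintegral => //.
  - exact: blip_integrable.
  - apply: (@bounded_integrable _ _ _ mu _ 1).
      by apply/(measurable_restrictT _ (mA k)); exact: measurable_cst.
    by move=> x; rewrite patchE; case: ifP => _; rewrite ?normr1 ?normr0.
  - move=> x _; rewrite patchE; case: ifPn => [_|]; first exact: F1.
    rewrite notin_setE /A /= => /negP; rewrite -ltNge => /ltW h.
    by rewrite /F !min_l ?subrr // (le_trans h).
rewrite -(ler_pM2l N0) mulrDr -blip_RintegralZ // -LZ //.
have -> : \int[mu]_x (N%:R * f x) = \sum_(k < N) \int[mu]_x F k x.
  by rewrite -blip_Rintegral_sum //; apply: eq_Rintegral => x _; rewrite sumF.
have -> : L (fun x => N%:R * f x) = \sum_(k < N) L (F k).
  by rewrite -L_sum //; congr L; apply/funext => x; rewrite sumF.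
(* The shift of index leaves the layer 0 unmatched. It costs at most 1, which [N * e] pays for. *)
apply: le_trans (_ : 1 + \sum_(k < N) \int[mu]_x F k.+1 x <= _).
  apply: le_trans (_ : \sum_(k < N.+1) \int[mu]_x F k x <= _).
    by rewrite [leRHS]big_ord_recr /= lerDl Rintegral_ge0.
  rewrite [leLHS]big_ord_recl /= lerD2r.
  rewrite -[leRHS](Rintegral1 mu); apply: blip_le_Rintegral => //.
  exact: blip_cst.
rewrite addrC; apply: lerD => //.
by apply: ler_sum => k _; apply: le_trans (FAS k) (AL k).
Qed.

(** The measure is [mstar] on Borel sets. An affine change brings [f] to a function [h] with values
    in [0, 1], and the inequality [integral_mstar_le], applied to [h] and to [1 - h], gives
    equality; [K + 1] keeps the scaling factor positive when [K] is 0. *)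
Theorem functional_representation : exists mu : probability (borel X) R,
  forall f, blip f -> L f = \int[mu]_x f x.
Proof.
have borel_cara : (measurable : set (set (borel X))) `<=` mstar.-caratheodory.
  apply: smallest_sub; last by move=> U; exact: open_mstar_caratheodory.
  split.
  - exact: caratheodory_measurable_set0.
  - by move=> A mA; rewrite setTD; exact: caratheodory_measurable_setC.
  - exact: caratheodory_measurable_bigcup.
have mstar_additive : semi_sigma_additive (mstar : set (borel X) -> \bar R).
  move=> F mF tF mUF.
  apply: (@caratheodory_measure_sigma_additive _ _ mstar) => //.
  - by move=> n; exact: borel_cara (mF n).
  - exact: borel_cara mUF.
pose mu_measure := isMeasure.Build _ (borel X) R mstar mstar0 mstar_ge0 mstar_additive.
pose mu0 : {measure set (borel X) -> \bar R} := HB.pack (mstar : set (borel X) -> \bar R) mu_measure.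
pose mu_prob := Measure_isProbability.Build _ (borel X) R mu0 mstarT.
pose mu : probability (borel X) R := HB.pack (mstar : set (borel X) -> \bar R) mu_measure mu_prob.
exists mu => f [K fK].
have muE (A : set X) : mu A = mstar A by [].
have K0 := blip_by_ge0 fK.
have K1 : 0 < 2 * (K + 1) by lra.
have bf : blip f by exists K.
have [fb _] := fK.
pose h x := (2 * (K + 1))^-1 * (f x + (K + 1)).
have bfK : blip (fun x => f x + (K + 1)) by apply: blipD => //; exact: blip_cst.
have bh : blip h by exact: blipZ.
have h01 x : 0 <= h x <= 1.
  have := fb x; rewrite ler_norml => /andP[? ?].
  have -> : h x = (f x + (K + 1)) / (2 * (K + 1)) by rewrite /h mulrC.
  by rewrite ler_pdivrMr // mul1r divr_ge0 /=; lra.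
have b1h : blip (fun x => 1 - h x) by apply: blipB => //; exact: blip_cst.
have le1 := integral_mstar_le muE bh h01.
have le2 : \int[mu]_x (1 - h x) <= L (fun x => 1 - h x).
  by apply: integral_mstar_le => // x; have := h01 x; lra.
have Lcst a : L (fun=> a) = a.
  rewrite -[RHS]mulr1 -L1 -LZ; last exact: blip_cst.
  by congr L; apply/funext => x; rewrite mulr1.
have hE : L h = \int[mu]_x h x.
  apply/eqP; rewrite eq_le le1 andbT.
  move: le2; rewrite LB ?L1 //; last exact: blip_cst.
  rewrite blip_RintegralB //; last exact: blip_cst.
  by rewrite Rintegral1 lerD2l lerN2.
move: hE; rewrite LZ // blip_RintegralZ //.
move=> /(mulfI (lt0r_neq0 (_ : 0 < _^-1))); rewrite invr_gt0 => /(_ K1).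
rewrite LD // ?blip_RintegralD //; do ?exact: blip_cst.
by rewrite Lcst !Rintegral1; exact: addIr.
Qed.

End Functional.

(** * Weak convergence *)

Lemma bounded_cvg_Rintegral (R : realType) d (T : measurableType d)
    (P : probability T R) (F : nat -> T -> R) (f : T -> R) (K : R) :
  (forall n, measurable_fun setT (F n)) ->
  (forall n x, `|F n x| <= K) ->
  (forall x, F n x @[n --> \oo] --> f x) ->
  \int[P]_x F n x @[n --> \oo] --> \int[P]_x f x.
Proof.
move=> mF FK Ff.
have mf : measurable_fun setT f.
  by apply: (measurable_fun_cvg mF) => x _; exact: Ff.
have fK x : `|f x| <= K.
  have cn : `|F n x| @[n --> \oo] --> `|f x| by apply: cvg_norm; exact: Ff.
  by apply: (cvgr_to_le cn); exact: nearW.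
have ig : P.-integrable setT (EFin \o (fun=> K)).
  by apply: (@bounded_integrable _ _ _ P _ `|K|) => //; exact: measurable_cst.
have [] := @dominated_convergence _ _ _ P setT measurableT
  (fun n x => (F n x)%:E) (EFin \o f) (EFin \o (fun=> K)) _ _ _ ig _.
- by move=> n; exact/measurable_EFinP.
- exact/measurable_EFinP.
- by apply: aeW => x _; apply: cvg_EFin; [exact: nearW|exact: Ff].
- by apply: aeW => x n _; rewrite lee_fin.
move=> /= intf _ cv.
have fin : (\int[P]_x (f x)%:E)%E \is a fin_num by exact: integrable_fin_num.
by apply: fine_cvg; rewrite fineK.
Qed.

Section WeakConvergence.
Context (R : realType) (X : completeNormedModType R).
Implicit Types (P Q : probability (borel X) R) (f h : X -> R).

(** Open sets form a generating system stable under intersections, and their indicators, being lower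
    semicontinuous, are limits of their envelopes. *)
Lemma probability_blip_unique P Q :
  (forall f, blip f -> (forall x, 0 <= f x <= 1) ->
    \int[P]_x f x = \int[Q]_x f x) ->
  forall A : set (borel X), measurable A -> P A = Q A.
Proof.
move=> PQ A mA.
apply: (@measure_unique _ R (borel X) (@open X) (fun=> setT)) => //.
- by move=> U V; exact: openI.
- by move=> _; exact: openT.
- by rewrite bigcup_const.
- move=> U oU; pose h : X -> R := \1_U.
  have h01 x : 0 <= h x <= 1.
    by rewrite /h indicE; case: (x \in U); rewrite !lexx ler01.
  have mU : (measurable : set (set (borel X))) U by exact: borel_open.
  have cvgh x : infconv h n x @[n --> \oo] --> h x.
    apply/cvgrPdist_le => e e0.
    have [n hn] : exists n, h x - e <= infconv h n x.
      apply: infconv_lsc => // d d0.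
      have [Ux|nUx] := pselect (U x).
        have : \forall y \near x, U y by exact: open_nbhs_nbhs.
        apply: filterS => y Uy.
        by rewrite /h !indicE !mem_set // gerBl ltW.
      apply: nearW => y; have /andP[hy _] := h01 y.
      by apply: le_trans hy; rewrite /h indicE memNset // sub0r oppr_le0 ltW.
    exists n => // m /= nm; rewrite ger0_norm ?subr_ge0 ?infconv_le_id //.
    by rewrite lerBlDr -lerBlDl (le_trans hn) // infconv_nd.
  have intU Q' : \int[Q']_x infconv h n x @[n --> \oo] --> fine (Q' U).
    have -> : fine (Q' U) = \int[Q']_x h x.
      by rewrite /Rintegral integral_indic // setIT.
    apply: (@bounded_cvg_Rintegral _ _ _ _ _ _ 1) => //.
      by move=> n; apply: blip_measurable; exact: infconv_blip.
    by move=> n x; rewrite ger0_norm ?infconv_ge0 ?infconv_le1.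
  have : fine (P U) = fine (Q U).
    apply: (cvg_unique _ (intU P)) => //.
    have -> : (fun n => \int[P]_x infconv h n x) = (fun n => \int[Q]_x infconv h n x).
      apply/funext => n; apply: PQ => [|x]; first exact: infconv_blip.
      by rewrite infconv_ge0 ?infconv_le1.
    exact: intU.
  by move=> e; rewrite -[LHS]fineK ?fin_num_measure // e fineK ?fin_num_measure.
- by move=> _; rewrite -ge0_fin_numE //; exact: fin_num_measure.
Qed.

(** An envelope of [h] with large slope loses at most [e / 2] under [Q]; convergence is known for
    it, and [h] dominates it under [P n]. *)
Let liminf_ge (P : nat -> probability (borel X) R) Q h :
  (forall f, blip f -> \int[P n]_x f x @[n --> \oo] --> \int[Q]_x f x) ->
  continuous h -> (forall x, 0 <= h x <= 1) ->
  forall e : R, 0 < e -> \forall n \near \oo, \int[Q]_x h x - e <= \int[P n]_x h x.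
Proof.
move=> PQ ch h01 e e0.
have e20 : 0 < e / 2 by rewrite divr_gt0.
have mh : measurable_fun setT (h : borel X -> R) by exact: borel_continuous.
have cvgh x : infconv h n x @[n --> \oo] --> h x.
  apply/cvgrPdist_le => d d0.
  have [n hn] : exists n, h x - d <= infconv h n x.
    apply: infconv_lsc => // c c0.
    by apply: (cvgr_ge _ (ch x)); rewrite gtrBl.
  exists n => // m /= nm; rewrite ger0_norm ?subr_ge0 ?infconv_le_id //.
  by rewrite lerBlDr -lerBlDl (le_trans hn) // infconv_nd.
have bi n : blip (infconv h n) by exact: infconv_blip.
have /cvgrPdist_le/(_ _ e20)[m _ /(_ m (leqnn m))] :
    \int[Q]_x infconv h n x @[n --> \oo] --> \int[Q]_x h x.
  apply: (@bounded_cvg_Rintegral _ _ _ _ _ _ 1) => //.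
    by move=> n; exact: blip_measurable.
  by move=> n x; rewrite ger0_norm ?infconv_ge0 ?infconv_le1.
move=> /= /(le_trans (ler_norm _)) Qm.
have /cvgrPdist_le/(_ _ e20) := PQ _ (bi m).
apply: filterS => n /(le_trans (ler_norm _)) Pm.
apply: le_trans (_ : \int[P n]_x infconv h m x <= _); first by lra.
apply: le_Rintegral => //.
- exact: blip_integrable.
- apply: (@bounded_integrable _ _ _ (P n) _ 1) => // x.
  by have /andP[? ?] := h01 x; rewrite ger0_norm.
- by move=> x _; exact: infconv_le_id.
Qed.

(** The lower bounds for [h] and for [1 - h] enclose the limit. The intended [h] is [Pt M t f]. *)
Lemma blip_cvg_continuous (P : nat -> probability (borel X) R) Q h :
  (forall f, blip f -> \int[P n]_x f x @[n --> \oo] --> \int[Q]_x f x) ->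
  continuous h -> (forall x, 0 <= h x <= 1) ->
  \int[P n]_x h x @[n --> \oo] --> \int[Q]_x h x.
Proof.
move=> PQ ch h01; apply/cvgrPdist_le => e e0.
have mh : measurable_fun setT (h : borel X -> R) by exact: borel_continuous.
have c1h : continuous (fun x => 1 - h x).
  by move=> x; apply: cvgB; [exact: cvg_cst|exact: ch].
have h01' x : 0 <= 1 - h x <= 1 by have := h01 x; lra.
have int1h Q' : \int[Q']_x (1 - h x) = 1 - \int[Q']_x h x.
  rewrite RintegralB ?Rintegral1 //.
    by apply: (@bounded_integrable _ _ _ Q' _ 1) => // x; rewrite normr1.
  apply: (@bounded_integrable _ _ _ Q' _ 1) => // x.
  by have /andP[? ?] := h01 x; rewrite ger0_norm.
have lo := liminf_ge PQ ch h01 e0; have up := liminf_ge PQ c1h h01' e0.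
apply: filterS2 lo up => n; rewrite !int1h ler_norml => lo up.
by apply/andP; split; lra.
Qed.

Hypothesis hX : separable X.

Lemma separable_seq : exists a : nat -> X, forall x e, 0 < e -> exists n, `|x - a n| < e.
Proof.
have [D [/countable_injP[f fI] dD]] := hX.
pose a k := xget 0 [set x | D x /\ f x = k].
exists a => x e e0.
have [||y [xy Dy]] := dD (ball x e).
  by exists x; exact: ballxx.
  exact: ball_open.
exists (f y).
suff -> : a (f y) = y by move: xy; rewrite -ball_normE.
rewrite /a; case: xgetP => [z -> [Dz fz]|/(_ y)]; last by case.
by apply: fI => //; rewrite inE.
Qed.

Lemma probability_tight P (e d : R) : 0 < e -> 0 < d ->
  exists s, 1 - e <= \int[P]_x bumps d s x.
Proof.
move=> e0 d0; have [a ha] := separable_seq.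
have : \int[P]_x bumps d (map a (iota 0 n)) x @[n --> \oo] --> \int[P]_x 1.
  apply: (@bounded_cvg_Rintegral _ _ _ _ _ _ 1).
  - by move=> n; apply: blip_measurable; eexists; exact: bumps_blip.
  - by move=> n x; rewrite ger0_norm ?bumps_ge0 ?bumps_le1.
  - move=> x; apply/cvgrPdist_le => c c0.
    have [k hk] := ha x (c * d) ltac:(by rewrite mulr_gt0).
    exists k.+1 => // n /= kn; rewrite ger0_norm ?subr_ge0 ?bumps_le1 //.
    rewrite lerBlDr -lerBlDl.
    have := @bumps_ge _ _ d (map a (iota 0 n)) (a k) x.
    have -> : a k \in map a (iota 0 n) by apply: map_f; rewrite mem_iota.
    move=> /(_ isT); apply: le_trans.
    rewrite /bump le_max; apply/orP; right.
    by rewrite lerD2l lerN2 ler_pdivrMr // ltW.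
rewrite Rintegral1 => /cvgrPdist_le/(_ _ e0)[n _ /(_ n (leqnn n))] /= h.
exists (map a (iota 0 n)).
by rewrite lerBlDr -lerBlDl; apply: le_trans h; exact: ler_norm.
Qed.

(** The limits of the integrals form a positive normalized functional, to which
    [functional_representation] applies once tightness is transferred from a single [P n]. *)
Theorem dual_lipschitz_complete (P : nat -> probability (borel X) R) (r : nat -> R) :
  r n @[n --> \oo] --> 0 ->
  (forall n m f, (n <= m)%N -> blip_by 1 f ->
    `|\int[P n]_x f x - \int[P m]_x f x| <= r n) ->
  exists Q, forall f, blip f -> \int[P n]_x f x @[n --> \oo] --> \int[Q]_x f x.
Proof.
move=> r0 Pr.
have PrK K n m f : (n <= m)%N -> blip_by K f ->
    `|\int[P n]_x f x - \int[P m]_x f x| <= (K + 1) * r n.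
  move=> nm fK; have K0 := blip_by_ge0 fK; have K1 : 0 < K + 1 by lra.
  have bf : blip f by exists K.
  have b1 : blip_by 1 (fun x => (K + 1)^-1 * f x).
    case: fK => bK lK; split=> [u|u v].
      rewrite normrM gtr0_norm ?invr_gt0 // mulrC ler_pdivrMr // mul1r.
      by apply: le_trans (bK u) _; lra.
    rewrite -mulrBr normrM gtr0_norm ?invr_gt0 // mulrC ler_pdivrMr //.
    by apply: le_trans (lK u v) _; rewrite mul1r mulrC ler_wpM2l //; lra.
  have := Pr n m _ nm b1; rewrite !blip_RintegralZ // -mulrBr normrM.
  by rewrite gtr0_norm ?invr_gt0 // mulrC ler_pdivrMr // mulrC.
have cP f : blip f -> cvg (\int[P n]_x f x @[n --> \oo]).
  move=> [K fK]; have K0 := blip_by_ge0 fK.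
  have cK : (K + 1) * r n @[n --> \oo] --> 0.
    by rewrite -(mulr0 (K + 1)); apply: cvgMr.
  apply/cauchy_cvgP/cauchyP => e e0.
  have /cvgrPdist_lt/(_ _ e0)[n _ hn] := cK.
  exists (\int[P n]_x f x); exists n => // m /= nm.
  rewrite -ball_normE /=; apply: le_lt_trans (PrK _ _ _ _ nm fK) _.
  by have := hn n (leqnn n); rewrite /= sub0r normrN; apply: le_lt_trans; exact: ler_norm.
pose L f := lim (\int[P n]_x f x @[n --> \oo]).
have PL f : blip f -> \int[P n]_x f x @[n --> \oo] --> L f by exact: cP.
have [||||e d e0 d0|Q LQ] := @functional_representation R X L.
- move=> f g bf bg; apply/cvg_lim => //.
  under eq_fun do rewrite blip_RintegralD //.
  by apply: cvgD; exact: PL.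
- move=> a f bf; apply/cvg_lim => //.
  under eq_fun do rewrite blip_RintegralZ //.
  by apply: cvgMr; exact: PL.
- move=> f g bf bg fg; apply: ler_cvg_to (PL _ bf) (PL _ bg) _.
  by apply: nearW => n; exact: blip_le_Rintegral.
- by apply/cvg_lim => //; under eq_fun do rewrite Rintegral1; exact: cvg_cst.
(* The order of choices matters: [n] is fixed from [e] and [d], and only then [s] from [P n]. This
   works because the Lipschitz constant [1 + d^-1] of [bumps d s] is the same for all [s]. *)
- have d1 : 0 < 1 + d^-1 + 1 by rewrite !addr_gt0 // invr_gt0.
  have e20 : 0 < e / 2 by rewrite divr_gt0.
  have er : 0 < e / 2 / (1 + d^-1 + 1) by rewrite divr_gt0.
  have /cvgrPdist_lt/(_ _ er)[n _ /(_ n (leqnn n))] := r0.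
  rewrite /= sub0r normrN => /(le_lt_trans (ler_norm _)) rn.
  have [s hs] := probability_tight (P n) e20 d0; exists s.
  have bs : blip (bumps d s) by eexists; exact: bumps_blip.
  apply: (cvgr_to_ge (PL _ bs)); exists n => // m /= nm.
  have := PrK _ _ _ _ nm (bumps_blip s d0).
  rewrite ltr_pdivlMr // mulrC in rn.
  by move=> /(le_trans (ler_norm _)); lra.
by exists Q => f bf; rewrite -LQ //; exact: PL.
Qed.

End WeakConvergence.

(** * Strong Markov property *)

Section Mixture.
Local Open Scope ereal_scope.
Context d (Z : measurableType d) (R : realType).

Import HBNNSimple.

Let mixture_nnsfun d1 (Y : measurableType d1) (mu : {measure set Y -> \bar R})
    (D : set Y) (k : Y -> {measure set Z -> \bar R}) (f : {nnsfun Z >-> R}) :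
  measurable D ->
  (forall U, measurable U -> measurable_fun setT (k ^~ U)) ->
  \int[mu]_(y in D) (\int[k y]_z (f z)%:E) =
  \sum_(r \in range f)
    (r%:E * \int[mu]_(y in D) k y (f @^-1` [set r])).
Proof.
move=> mD mk.
have sumE (m : {measure set Z -> \bar R}) : \int[m]_z (f z)%:E =
    \sum_(r \in range f) (r%:E * m (f @^-1` [set r])).
  under eq_integral do rewrite fimfunE -fsumEFin//.
  rewrite ge0_integral_fsum//; last 2 first.
  - by move=> r; exact/measurable_EFinP/measurableT_comp.
  - by move=> r z _; rewrite EFinM nnfun_muleindic_ge0.
  apply: eq_fsbigr => r _.
  rewrite (integralZl_indic _ (fun r => f @^-1` [set r]))//; last first.
    by move=> r0; rewrite preimage_nnfun0.
  by rewrite integral_indic// setIT.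
under [in LHS]eq_integral do rewrite sumE.
rewrite ge0_integral_fsum//; last 2 first.
- by move=> r; apply: measurable_funeM; exact/measurable_funTS/mk.
- move=> r y _.
  have := mulemu_ge0 (fun r => f @^-1` [set r]).
  by apply; exact: preimage_nnfun0.
apply: eq_fsbigr => r _.
have [r0|r0] := leP 0%R r.
  by rewrite ge0_integralZl //; exact/measurable_funTS/mk.
rewrite preimage_nnfun0 //.
rewrite integral0_eq; last by move=> y _; rewrite measure0 mule0.
by rewrite integral0_eq ?mule0 // => y _; rewrite measure0.
Qed.

Let mixture_lim d1 (Y : measurableType d1) (mu : {measure set Y -> \bar R})
    (D : set Y) (k : Y -> {measure set Z -> \bar R}) (h : Z -> \bar R)
    (mh : measurable_fun setT h) :
  measurable D ->
  (forall U, measurable U -> measurable_fun setT (k ^~ U)) ->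
  (forall z, 0 <= h z) ->
  \int[mu]_(y in D) (\int[k y]_z h z) = limn (fun n =>
    \int[mu]_(y in D) (\int[k y]_z (nnsfun_approx measurableT mh n z)%:E)).
Proof.
move=> mD mk h0; pose f := nnsfun_approx measurableT mh.
have cvgE (m : {measure set Z -> \bar R}) :
    \int[m]_z h z = limn (fun n => \int[m]_z (f n z)%:E).
  rewrite -monotone_convergence//.
  - by apply: eq_integral => z _; apply/esym/cvg_lim => //; exact: cvg_nnsfun_approx.
  - by move=> n; exact/measurable_EFinP.
  - by move=> n z _; rewrite lee_fin.
  - by move=> z _ a b ab; rewrite lee_fin; exact/lefP/nd_nnsfun_approx.
under [in LHS]eq_integral do rewrite cvgE.
rewrite monotone_convergence//.
- move=> n; apply/measurable_funTS/measurable_fun_integral_kernel => //.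
  + by move=> z; rewrite lee_fin.
  + exact/measurable_EFinP.
- by move=> n y _; apply: integral_ge0 => z _; rewrite lee_fin.
- move=> y _ a b ab; apply: ge0_le_integral => //.
  + by move=> z _; rewrite lee_fin.
  + exact/measurable_EFinP.
  + exact/measurable_EFinP.
  + by move=> z _; rewrite lee_fin; exact/lefP/nd_nnsfun_approx.
Qed.

(** An identity between mixtures known on sets passes to simple functions and then to monotone
    limits. With Dirac kernels on one side, it covers both the Markov property and the integration
    against a mixture. *)
Lemma ge0_integral_mixture_eq d1 d2 (Y1 : measurableType d1)
    (Y2 : measurableType d2) (mu1 : {measure set Y1 -> \bar R})
    (mu2 : {measure set Y2 -> \bar R}) (D1 : set Y1) (D2 : set Y2)
    (k1 : Y1 -> {measure set Z -> \bar R})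
    (k2 : Y2 -> {measure set Z -> \bar R}) (h : Z -> \bar R) :
  measurable D1 -> measurable D2 ->
  (forall U, measurable U -> measurable_fun setT (k1 ^~ U)) ->
  (forall U, measurable U -> measurable_fun setT (k2 ^~ U)) ->
  (forall U, measurable U ->
    \int[mu1]_(y in D1) k1 y U = \int[mu2]_(y in D2) k2 y U) ->
  (forall z, 0 <= h z) -> measurable_fun setT h ->
  \int[mu1]_(y in D1) (\int[k1 y]_z h z) =
  \int[mu2]_(y in D2) (\int[k2 y]_z h z).
Proof.
move=> mD1 mD2 mk1 mk2 k12 h0 mh.
rewrite (mixture_lim _ mh) // (mixture_lim _ mh) //.
congr (limn _); apply/funext => n.
rewrite !mixture_nnsfun //; apply: eq_fsbigr => r _.
by rewrite k12.
Qed.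

Lemma ge0_integral_mixture d1 (Y : measurableType d1)
    (mu : {measure set Y -> \bar R}) (D : set Y) (f : Y -> Z)
    (k : Y -> {measure set Z -> \bar R}) (h : Z -> \bar R) :
  measurable D -> measurable_fun setT f ->
  (forall U, measurable U -> measurable_fun setT (k ^~ U)) ->
  (forall U, measurable U ->
    mu (D `&` f @^-1` U) = \int[mu]_(y in D) k y U) ->
  (forall z, 0 <= h z) -> measurable_fun setT h ->
  \int[mu]_(y in D) h (f y) = \int[mu]_(y in D) (\int[k y]_z h z).
Proof.
move=> mD mf mk fk h0 mh.
have mfU U : measurable U -> measurable (f @^-1` U).
  by move=> mU; rewrite -[X in measurable X]setTI; exact: mf.
rewrite -(@ge0_integral_mixture_eq _ _ _ _ mu mu D D (fun y => \d_(f y)) k) //.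
- apply: eq_integral => y _.
  by rewrite integral_dirac // diracT mul1e.
- move=> U mU; exact: measurableT_comp (measurable_fun_dirac mU) mf.
- by move=> U mU; rewrite -fk // setIC -integral_indic //; exact: mfU.
Qed.

End Mixture.

(** Subtraction is not directly available for the product sigma-algebra. By the triangle inequality,
    the distance of x and y is the infimum of |x - a n| + |y - a n| over a dense sequence, and each
    summand depends on one component. *)
Lemma measurable_normB (R : realType) (X : completeNormedModType R) :
  separable X ->
  measurable_fun setT (fun x : (borel X * borel X)%type => `|(x.1 : X) - (x.2 : X)|).
Proof.
move=> hX; have [a ha] := separable_seq hX.
pose h n (x : (borel X * borel X)%type) : R :=
  `|(x.1 : X) - a n| + `|(x.2 : X) - a n|.
have mn n : measurable_fun setT (fun x : borel X => `|(x : X) - a n|).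
  apply: borel_continuous => x; apply: cvg_norm; apply: cvgB; first exact: cvg_id.
  exact: cvg_cst.
have mh n : measurable_fun setT (h n).
  apply: measurable_funD.
    exact: measurableT_comp (mn n) measurable_fst.
  exact: measurableT_comp (mn n) measurable_snd.
have h0 n x : 0 <= h n x by rewrite addr_ge0.
rewrite [X in measurable_fun _ X](_ : _ = (fun x => infs (h ^~ x) 0)); last first.
  apply/funext => x; rewrite /infs /=; apply/eqP; rewrite eq_le; apply/andP; split.
    apply: lb_le_inf; first by exists (h 0%N x), 0%N.
    move=> _ [n _ <-]; rewrite /h (distrC x.2).
    by rewrite -(subrKA (a n)) ler_normD.
  apply/ler_addgt0Pr => e e0.
  have [n hn] := ha (x.1 : X) (e / 2) ltac:(by rewrite divr_gt0).
  apply: le_trans (_ : h n x <= _).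
    by apply: ge_inf; [exists 0 => _ [m _ <-]|exists n].
  have : `|(x.2 : X) - a n| <= `|(x.1 : X) - (x.2 : X)| + `|(x.1 : X) - a n|.
    by rewrite (distrC (x.1 : X) x.2) -[X in `|X|](subrKA (x.1 : X)) ler_normD.
  by rewrite /h => ?; lra.
by apply: measurable_fun_infs => // x _; exists 0 => _ [m _ <-].
Qed.

Lemma stopping_measurable (R : realType) d (Omega : measurableType d)
    (tau : Omega -> \bar R) :
  (forall r : R, measurable [set w | (tau w <= r%:E)%E]) ->
  measurable_fun setT tau.
Proof.
move=> mtau; apply: (measurability _ (ErealGenOInfty.measurableE R)).
move=> _ [_ [r ->] <-]; rewrite setTI.
rewrite [X in measurable X](_ : _ = ~` [set w | (tau w <= r%:E)%E]).
  exact: measurableC.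
apply/seteqP; split=> w /=; rewrite in_itv /= andbT ltNge.
  by move=> /negP.
by move=> ?; apply/negP.
Qed.

Section KernelProbability.
Context (R : realType) d d' (X : measurableType d) (Y : measurableType d').
Variables (k : R.-pker X ~> Y) (x : X).

(* The values of a probability kernel are only declared as measures. *)
Definition kernel_at : set Y -> \bar R := k x.

HB.instance Definition _ := isMeasure.Build _ _ _ kernel_at
  (measure0 (k x)) (measure_ge0 (k x)) (@measure_semi_sigma_additive _ _ _ (k x)).

HB.instance Definition _ :=
  Measure_isProbability.Build _ _ _ kernel_at (prob_kernel x).

Lemma pkernel_le1 A : measurable A -> (k x A <= 1)%E.
Proof. exact: (@probability_le1 _ _ _ kernel_at). Qed.

Lemma pkernel_setC A : measurable A -> (k x (~` A) = 1 - k x A)%E.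
Proof. exact: (@probability_setC _ _ _ kernel_at). Qed.

End KernelProbability.

Section TimeSet.
Context (R : realType) (T : set R).
Hypothesis hT : is_time_set T.

Lemma time_plus0 : time_plus T 0.
Proof. by split=> //; case: hT => ->//; exists 0. Qed.

Lemma time_plusD s t : time_plus T s -> time_plus T t -> time_plus T (s + t).
Proof.
move=> [Ts s0] [Tt t0]; split; last exact: addr_ge0.
case: hT Ts Tt => -> // [i _ <-] [j _ <-].
by exists (i + j) => //; rewrite rmorphD.
Qed.

Lemma time_plus_nat n : time_plus T n%:R.
Proof. by split=> //; case: hT => -> //; exists n%:Z. Qed.

Lemma discrete_time_plus : T <> setT ->
  forall t, time_plus T t -> exists n, t = n%:R.
Proof.
move=> TT t [Tt t0]; case: hT Tt => // -> [[n|n] _ nt]; first by exists n.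
by move: t0; rewrite -nt ler0z.
Qed.

(** A stopping time is controlled at the times of [T], but its measurability involves every real
    level: a level between two times amounts to the last time before it. *)
Lemma time_plus_floor (r : R) : 0 <= r ->
  exists2 t, time_plus T t & forall s, time_plus T s -> (s <= r) = (s <= t).
Proof.
move=> r0; have [TT|TT] := pselect (T = setT).
  by exists r => //; split=> //; rewrite TT.
exists (Num.trunc r)%:R; first exact: time_plus_nat.
move=> s /(discrete_time_plus TT)[n ->].
by rewrite ler_nat truncn_ge_nat.
Qed.

End TimeSet.

Section StrongMarkov.
Context (R : realType) (T : set R) (hT : is_time_set T).
Context d (S : measurableType d) d' (Omega : measurableType d').
Variable E : markov_family T S Omega.

Local Notation law := (mf_law E).

(** Where [tau] is infinite, [fine] returns 0 and the shift is the identity. *)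
Definition shift_at (tau : Omega -> \bar R) (w : Omega) : Omega :=
  mf_shift E (fine (tau w)) w.

Lemma filt_measurable t A : time_plus T t -> mf_filt E t A -> measurable A.
Proof. by move=> tT; exact: mf_filt_sub. Qed.

Lemma filt_sigmaE t : time_plus T t ->
  (mf_filt E t).-sigma.-measurable = mf_filt E t.
Proof.
by move=> tT; apply: measurable_g_measurableTypeE; exact: mf_filt_sigma.
Qed.

Lemma proc_measurable t : time_plus T t -> measurable_fun setT (mf_proc E t).
Proof.
move=> tT _ A mA; rewrite setTI.
by apply: (filt_measurable tT); exact: mf_adapted.
Qed.

Lemma law_proc_measurable t G : time_plus T t -> measurable G ->
  measurable_fun setT (fun w => law (mf_proc E t w) G).
Proof.
move=> tT mG.
exact: measurableT_comp (measurable_kernel law G mG) (proc_measurable tT).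
Qed.

Lemma markov_integral (x : S) t (h : Omega -> \bar R) : time_plus T t ->
  (forall w, 0 <= h w)%E -> measurable_fun setT h ->
  (\int[law x]_w h (mf_shift E t w) =
   \int[law x]_w \int[law (mf_proc E t w)]_v h v)%E.
Proof.
move=> tT h0 mh.
apply: (@ge0_integral_mixture _ _ _ _ _ (law x) setT (mf_shift E t)
  (fun w => law (mf_proc E t w))) => //.
- exact: mf_shift_measurable.
- by move=> U mU; exact: law_proc_measurable.
- move=> U mU; rewrite mf_markov //.
  by rewrite -(filt_sigmaE tT); exact: measurableT.
Qed.

(* The strong Markov property in the form used below: restarting at [tau]
   with the total function [shift_at tau]. *)
Definition regular_time (tau : Omega -> \bar R) :=
  [/\ forall w, tau w = +oo%E \/ exists2 t, time_plus T t & tau w = t%:E,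
      measurable_fun setT tau, measurable_fun setT (shift_at tau) &
      forall x G, measurable G ->
        law x ([set w | (tau w < +oo)%E] `&` shift_at tau @^-1` G) =
        (\int[law x]_(w in [set w | (tau w < +oo)%E])
           law (mf_proc E 0 (shift_at tau w)) G)%E].

Lemma stopping_time_measurable tau : stopping_time E tau ->
  measurable_fun setT tau.
Proof.
move=> [tauT tauF]; apply: stopping_measurable => r.
have [r0|r0] := ltP r 0.
  rewrite [X in measurable X](_ : _ = set0) //.
  apply/seteqP; split=> w //=; case: (tauT w) => [->|[t [_ t0] ->]] //.
  by rewrite lee_fin => /(le_trans t0); rewrite leNgt r0.
have [t tT rt] := time_plus_floor hT r0.
rewrite [X in measurable X](_ : _ = [set w | (tau w <= t%:E)%E]).
  exact: filt_measurable (tauF t tT).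
apply/seteqP; split=> w /=; case: (tauT w) => [->|[s sT ->]] //;
  by rewrite !lee_fin rt.
Qed.

Lemma shift_at0 tau w : tau w = +oo%E -> shift_at tau w = w.
Proof. by rewrite /shift_at => ->; rewrite mf_shift0. Qed.

(** Makes the state at a random time a composition of the measurable maps [mf_proc E 0] and
    [shift_at tau]. *)
Lemma proc0_shift_at tau w :
  (forall w, tau w = +oo%E \/ exists2 t, time_plus T t & tau w = t%:E) ->
  mf_proc E 0 (shift_at tau w) = mf_proc E (fine (tau w)) w.
Proof.
move=> tauT; rewrite /shift_at mf_proc_shift ?add0r //.
  exact: time_plus0.
by case: (tauT w) => [->|[t tT ->]] //=; exact: time_plus0.
Qed.

Let infin_measurable (tau : Omega -> \bar R) : measurable_fun setT tau ->
  measurable [set w | tau w = +oo%E].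
Proof.
move=> mtau; have := mtau measurableT [set +oo%E] (emeasurable_set1 _).
by rewrite setTI.
Qed.

Lemma strong_markov_regular tau : strong_markov E -> stopping_time E tau ->
  regular_time tau.
Proof.
move=> sm st; have mtau := stopping_time_measurable st.
have [tauT tauF] := st.
split=> //.
  move=> _ G mG; rewrite setTI.
  have [mf _] := sm tau st G mG.
  rewrite (_ : _ @^-1` _ = ([set w | (tau w < +oo)%E] `&`
      [set w | G (mf_shift E (fine (tau w)) w)]) `|`
      ([set w | tau w = +oo%E] `&` G)).
    by apply: measurableU => //; apply: measurableI => //; exact: infin_measurable.
  apply/seteqP; split=> w /=.
    move=> Gw; case: (tauT w) => [tw|[t tT tw]]; [right|left].
      by split=> //; move: Gw; rewrite shift_at0.
    by split=> //; rewrite tw ltry.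
  by move=> [[]//|[tw Gw]]; rewrite shift_at0.
move=> x G mG; have [mf] := sm tau st G mG.
have sT : stopped_events E tau setT.
  by split=> // t tT; rewrite setTI; exact: tauF.
move=> /(_ x _ sT); rewrite !setTI => h; apply: etrans h _.
by apply: eq_integral => w _; rewrite proc0_shift_at.
Qed.

(** The event that [tau] is finite is the countable disjoint union of the events [tau = n], each of
    which belongs to the filtration at time [n]; the simple Markov property holds on each and the
    pieces are summed. *)
Lemma discrete_regular tau : T <> setT -> stopping_time E tau ->
  regular_time tau.
Proof.
move=> TT st; have mtau := stopping_time_measurable st.
have [tauT tauF] := st.
have nT := time_plus_nat hT.
pose A n := [set w | tau w = n%:R%:E].
have fA n : mf_filt E n%:R (A n).
  rewrite -(filt_sigmaE (nT n)).
  case: n => [|n].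
    rewrite (_ : A _ = [set w | (tau w <= 0%:R%:E)%E]).
      by rewrite (filt_sigmaE (nT _)); exact: tauF.
    apply/seteqP; split=> w /=; rewrite /A /=; first by move=> ->.
    case: (tauT w) => [->|[t [_ t0] ->]] //; rewrite lee_fin => t0'.
    by congr EFin; apply/eqP; rewrite eq_le t0' t0.
  rewrite (_ : A _ = [set w | (tau w <= n.+1%:R%:E)%E] `\`
      [set w | (tau w <= n%:R%:E)%E]).
    apply: measurableD; rewrite (filt_sigmaE (nT _)); first exact: tauF.
    by apply: (@mf_filt_mono _ _ _ _ _ _ E n%:R) (tauF _ (nT n)) => //; rewrite ler_nat.
  apply/seteqP; split=> w; rewrite /A /=.
    by move=> ->; rewrite !lee_fin !ler_nat leqnn ltnn.
  case: (tauT w) => [->|[t /(discrete_time_plus hT TT)[k ->] ->]] /=.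
    by case; rewrite leye_eq.
  by rewrite !lee_fin !ler_nat => -[k1 /negP]; rewrite -ltnNge => k2;
    congr (_%:R%:E); apply/eqP; rewrite eqn_leq k1.
have mA n : measurable (A n) by exact: filt_measurable (fA n).
have finE : [set w | (tau w < +oo)%E] = \bigcup_n A n.
  apply/seteqP; split=> w /=.
    case: (tauT w) => [->|[t /(discrete_time_plus hT TT)[k ->] tw]] //.
    by move=> _; exists k.
  by move=> [n _]; rewrite /A /= => ->; rewrite ltry.
have tA : trivIset setT A.
  move=> i j _ _ [w []]; rewrite /A /= => -> [] /eqP.
  by rewrite eqr_nat => /eqP.
have sA n w : A n w -> shift_at tau w = mf_shift E n%:R w.
  by rewrite /A /shift_at /= => ->.
have preE G : [set w | (tau w < +oo)%E] `&` shift_at tau @^-1` G =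
    \bigcup_n (A n `&` mf_shift E n%:R @^-1` G).
  rewrite finE setI_bigcupl; apply: eq_bigcupr => n _.
  by apply/seteqP; split=> w /= [Aw]; rewrite ?(sA _ _ Aw) // => ?; split.
have mpre n G : measurable G -> measurable (A n `&` mf_shift E n%:R @^-1` G).
  move=> mG; apply: measurableI => //.
  by rewrite -[X in measurable X]setTI; apply: mf_shift_measurable.
have mshift : measurable_fun setT (shift_at tau).
  move=> _ G mG; rewrite setTI.
  rewrite (_ : _ @^-1` _ = ([set w | (tau w < +oo)%E] `&` shift_at tau @^-1` G) `|`
      ([set w | tau w = +oo%E] `&` G)).
    apply: measurableU; last by apply: measurableI => //; exact: infin_measurable.
    by rewrite preE; apply: bigcupT_measurable => n; exact: mpre.
  apply/seteqP; split=> w /=.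
    move=> Gw; case: (tauT w) => [tw|[t tT tw]]; [right|left].
      by split=> //; move: Gw; rewrite shift_at0.
    by split=> //; rewrite tw ltry.
  by move=> [[]//|[tw Gw]]; rewrite shift_at0.
split=> // x G mG.
rewrite preE measure_bigcup; last 2 first.
- by move=> n _; exact: mpre.
- by move=> i j _ _ [w [[Ai _] [Aj _]]]; apply: tA => //; exists w.
rewrite finE ge0_integral_bigcup //; last first.
  apply/measurable_funTS.
  apply: measurableT_comp (measurable_kernel law G mG) _.
  exact: measurableT_comp (proc_measurable (time_plus0 hT)) mshift.
rewrite [LHS]eseries_mkcond; apply: eq_eseriesr => n _; rewrite in_setT.
rewrite mf_markov //; apply: eq_integral => w; rewrite inE => Aw.
by rewrite (sA _ _ Aw) mf_proc_shift ?add0r //; exact: time_plus0.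
Qed.

End StrongMarkov.

(** * First entrance times *)

Section FirstTime.
Context (R : realType) (T : set R) (hT : is_time_set T).
Context d (S : measurableType d) d' (Omega : measurableType d').
Variable E : markov_family T S Omega.
Variable H : R -> Omega -> Prop.

Lemma first_time_le t w : time_plus T t -> H t w -> (first_time T H w <= t%:E)%E.
Proof. by move=> tT Ht; apply: ereal_inf_lbound; exists t. Qed.

Lemma first_time_discrete w : T <> setT ->
  first_time T H w = +oo%E \/
  exists n, H n%:R w /\ first_time T H w = n%:R%:E.
Proof.
move=> TT; have [[t [tT Ht]]|h] := pselect (exists t, time_plus T t /\ H t w); last first.
  left; rewrite /first_time (_ : [set t%:E | t in _] = set0) ?ereal_inf0 //.
  by apply/seteqP; split=> // y [t ht _]; exfalso; apply: h; exists t.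
right; have [n nt] := discrete_time_plus hT TT tT.
have ex : exists n, `[< H n%:R w >] by exists n; apply/asboolP; rewrite -nt.
case: (ex_minnP ex) => k /asboolP Hk kmin; exists k; split=> //.
apply/eqP; rewrite eq_le; apply/andP; split.
  by apply: first_time_le => //; exact: time_plus_nat.
apply: le_ereal_inf_tmp => _ [s [sT Hs] <-].
have [m sm] := discrete_time_plus hT TT sT.
by rewrite sm lee_fin ler_nat; apply: kmin; apply/asboolP; rewrite -sm.
Qed.

Lemma first_time_stopping : T <> setT ->
  (forall t, time_plus T t -> mf_filt E t [set w | H t w]) ->
  stopping_time E (first_time T H).
Proof.
move=> TT HF; split=> [w|t tT].
  have [->|[n [_ ->]]] := first_time_discrete w TT; first by left.
  by right; exists n%:R => //; exact: time_plus_nat.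
have [n nt] := discrete_time_plus hT TT tT.
rewrite (_ : [set w | _] = \bigcup_(k in [set k | (k <= n)%N]) [set w | H k%:R w]).
  rewrite -(filt_sigmaE E tT); apply: bigcup_measurable => k /= kn.
  rewrite filt_sigmaE //; apply: (@mf_filt_mono _ _ _ _ _ _ E k%:R) => //.
  - exact: time_plus_nat.
  - by rewrite nt ler_nat.
  - exact/HF/time_plus_nat.
apply/seteqP; split=> w /=.
  have [->|[k [Hk ->]]] := first_time_discrete w TT; first by rewrite leye_eq.
  by rewrite nt lee_fin ler_nat => kn; exists k.
move=> [k /= kn Hk]; apply: le_trans (first_time_le (time_plus_nat hT k) Hk) _.
by rewrite nt lee_fin ler_nat.
Qed.

End FirstTime.

Section HittingTimes.
Context (R : realType) (T : set R) (hT : is_time_set T).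
Context (X : completeNormedModType R) (hX : separable X).
Context d (Omega : measurableType d).
Variable E : markov_family T (borel X * borel X)%type Omega.
Variables (B : set X) (p C : R).
Hypothesis cB : closed B.
Hypothesis hreg : T = setT -> continuous_time_regular E B p C.

Lemma tauB_regular : regular_time E (tauB E B).
Proof.
have [TT|TT] := pselect (T = setT).
  by have [_ sm st _] := hreg TT; exact: strong_markov_regular.
apply: discrete_regular => //; apply: first_time_stopping => // t tT.
by apply: mf_adapted => //; apply: measurableX; exact: borel_closed.
Qed.

Lemma sigma_regular : regular_time E (sigma E C p).
Proof.
have [TT|TT] := pselect (T = setT).
  by have [_ sm _ st] := hreg TT; exact: strong_markov_regular.
apply: discrete_regular => //; apply: first_time_stopping => // t tT.
have := @mf_adapted _ _ _ _ _ _ E _ _ tT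
  (measurable_normB hX measurableT (measurable_itv `[C * (t + 1) `^ (- p), +oo[)).
rewrite setTI; congr (mf_filt E t _).
by apply/seteqP; split=> w /=; rewrite in_itv /= andbT.
Qed.

(** In discrete time the infimum is attained. In continuous time, if the state at the infimum were
    outside, hits would occur at later times arbitrarily close to it; right-continuity of both
    components and closedness of [B] then put it inside. *)
Lemma proc_tauB w : (tauB E B w < +oo)%E ->
  (B `*` B) (mf_proc E (fine (tauB E B w)) w).
Proof.
have [TT|TT] := pselect (T = setT); last first.
  rewrite /tauB.
  by have [->|[n [Hn ->]]] := first_time_discrete hT
    (fun t w => (B `*` B) (mf_proc E t w)) w TT.
have [rc _ _ _] := hreg TT; have [tauT _ _ _] := tauB_regular.
case: (tauT w) => [->//|[t [_ t0] tw] _]; rewrite tw /=.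
have [cv1 cv2] := rc w t t0.
apply: contrapT => nBt.
have near_hit : forall e : R, 0 < e ->
    exists s, [/\ t < s, s < t + e & (B `*` B) (mf_proc E s w)].
  move=> e e0.
  have tfin : tauB E B w \is a fin_num by rewrite tw.
  have [_ [s [[_ s0] Bs] <-]] := lb_ereal_inf_adherent e0 tfin.
  move=> ste'; have ste : s < t + e.
    have : (s%:E < tauB E B w + e%:E)%E by exact: ste'.
    by rewrite tw.
  exists s; split=> //; rewrite lt_neqAle; apply/andP; split.
    by apply/eqP => ts; apply: nBt; rewrite ts.
  rewrite -lee_fin -tw; apply: first_time_le => //; split=> //.
  by rewrite TT.
have inB (f : R -> X) : f @ t^'+ --> f t ->
    (forall s, (B `*` B) (mf_proc E s w) -> B (f s)) -> B (f t).
  move=> cf fB; apply: cB => V /cf /nbhs_ballP[e /= e0 he].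
  have [s [ts se Bs]] := near_hit e e0.
  exists (f s); split; first exact: fB.
  apply: he => //; rewrite -ball_normE /= distrC gtr0_norm ?subr_gt0 //.
  by rewrite ltrBlDl.
apply: nBt; split.
  by apply: inB cv1 _ => s [].
by apply: inB cv2 _ => s [].
Qed.

End HittingTimes.

(** * Regeneration times *)

Section PowerInequalities.
Context (R : realType).
Implicit Types (x y p : R).

Lemma powR_add_le x y p : 0 < p -> 0 <= x -> 0 <= y ->
  (x + y) `^ p <= 2 `^ p * (x `^ p + y `^ p).
Proof.
move=> p0 x0 y0; wlog xy : x y x0 y0 / x <= y.
  have [xy|/ltW yx] := leP x y; first exact.
  by rewrite addrC [_ `^ p + _]addrC; exact.
apply: le_trans (_ : (2 * y) `^ p <= _).
  by apply: ge0_ler_powR; rewrite ?nnegrE; lra.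
by rewrite powRM // ler_wpM2l ?powR_ge0 // lerDr powR_ge0.
Qed.

(** A factor close to 1 in front of [x] is what lets the recursion of [settle_moment] contract. The
    threshold [th] solves (1 + th)^p = 1 + eta: if [y] is at most [th * x], the first term suffices,
    and otherwise [x] is at most a multiple of [y]. *)
Lemma powR_add_eps (p eta : R) : 0 < p -> 0 < eta -> exists2 c, 0 < c &
  forall x y, 0 <= x -> 0 <= y -> (x + y) `^ p <= (1 + eta) * x `^ p + c * y `^ p.
Proof.
move=> p0 eta0; pose th := (1 + eta) `^ p^-1 - 1.
have e1 : 1 < 1 + eta by rewrite ltrDl.
have th1 : (1 + th) `^ p = 1 + eta.
  by rewrite /th addrC subrK -powRrM mulVf ?lt0r_neq0 // powRr1 //; lra.
have th0 : 0 < th.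
  rewrite ltNge; apply/negP => th0.
  have : (1 + th) `^ p <= 1 `^ p.
    apply: ge0_ler_powR; rewrite ?nnegrE; [lra| |lra|lra].
    by rewrite /th addrC subrK powR_ge0.
  by rewrite th1 powR1 leNgt e1.
exists ((1 + th^-1) `^ p) => [|x y x0 y0].
  by rewrite powR_gt0 // addr_gt0 // invr_gt0.
have [yx|xy] := leP y (th * x).
  apply: le_trans (_ : ((1 + th) * x) `^ p <= _).
    apply: ge0_ler_powR; rewrite ?nnegrE; [lra|lra| |lra].
    by rewrite mulr_ge0 //; lra.
  rewrite powRM //; last lra.
  by rewrite th1 lerDl mulr_ge0 ?powR_ge0.
have th'0 : 0 < th^-1 by rewrite invr_gt0.
have xy' : x <= th^-1 * y by rewrite mulrC ler_pdivlMr // mulrC ltW.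
apply: le_trans (_ : ((1 + th^-1) * y) `^ p <= _).
  apply: ge0_ler_powR; rewrite ?nnegrE; [lra|lra| |lra].
  by rewrite mulr_ge0 //; lra.
rewrite powRM //; last lra.
by rewrite lerDr mulr_ge0 ?powR_ge0 //; lra.
Qed.

(* Young's inequality with unequal exponents; it replaces the use of Hoelder's
   inequality to trade moments of order [p] for probabilities. *)
Lemma powR_young y p p0 e : 0 < p0 -> p0 < p -> 0 <= y -> 0 < e ->
  y `^ p0 <= e * y `^ p + e `^ (- (p0 / (p - p0))).
Proof.
move=> p00 p0p y0 e0; have pp0 : 0 < p - p0 by rewrite subr_gt0.
have [->|yn0] := eqVneq y 0.
  by rewrite powR0 ?lt0r_neq0 // addr_ge0 ?mulr_ge0 ?powR_ge0 // ltW.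
have ypE : y `^ p = y `^ p0 * y `^ (p - p0).
  by rewrite -powRD ?yn0 ?implybT // addrC subrK.
have [h|h] := leP e^-1 (y `^ (p - p0)).
  apply: le_trans (_ : e * y `^ p <= _); last by rewrite lerDl powR_ge0.
  rewrite ypE mulrCA -[leLHS]mulr1 ler_wpM2l ?powR_ge0 //.
  by rewrite -(mulfV (lt0r_neq0 e0)) ler_wpM2l // ltW.
apply: le_trans (_ : e `^ (- (p0 / (p - p0))) <= _); last first.
  by rewrite lerDr mulr_ge0 ?powR_ge0 // ltW.
have -> : y `^ p0 = (y `^ (p - p0)) `^ (p0 / (p - p0)).
  by rewrite -powRrM mulrCA divff ?lt0r_neq0 // mulr1.
have -> : e `^ (- (p0 / (p - p0))) = e^-1 `^ (p0 / (p - p0)).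
  by rewrite -(powR_inv1 (ltW e0)) -powRrM mulN1r.
apply: ge0_ler_powR; rewrite ?nnegrE ?powR_ge0 //; last exact: ltW.
  by rewrite divr_ge0 // ltW.
by rewrite invr_ge0 ltW.
Qed.

Lemma geometric_sum_le (s : R) n : 0 <= s -> s < 1 ->
  \sum_(k < n) s ^+ k <= (1 - s)^-1.
Proof.
move=> s0 s1; have s1' : 0 < 1 - s by rewrite subr_gt0.
rewrite -(ler_pM2l s1') divff ?lt0r_neq0 //.
by rewrite -opprB mulNr -subrX1 opprB gerBl exprn_ge0.
Qed.

End PowerInequalities.

Lemma integral_indicM (R : realType) d (T : measurableType d)
    (P : {measure set T -> \bar R}) (D : set T) (f : T -> R) :
  (\int[P]_w (\1_D w * f w)%:E = \int[P]_(w in D) (f w)%:E)%E.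
Proof.
rewrite [RHS]integral_mkcond; apply: eq_integral => w _.
by rewrite patchE indicE; case: (w \in D); rewrite ?mul1r ?mul0r.
Qed.

(** * Cycles of hitting and failed squeezing *)

Section Regeneration.
Context (R : realType) (T : set R) (hT : is_time_set T).
Context d (S : measurableType d) d' (Omega : measurableType d').
Variable E : markov_family T S Omega.
Variables (tau sg : Omega -> \bar R) (BB : set S) (G : S -> R).
Variables (p delta c K : R).

Local Notation law := (mf_law E).
Local Notation fin t := [set w | (t w < +oo)%E].
Local Notation restart t := (shift_at E t).

Hypotheses (rtau : regular_time E tau) (rsg : regular_time E sg).
Hypotheses (mG : measurable_fun setT G) (G1 : forall x, 1 <= G x).
Hypotheses (p0 : 0 < p) (delta0 : 0 < delta) (delta1 : delta < 1).
Hypotheses (c0 : 0 <= c) (K0 : 0 <= K).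
Hypothesis tau_moment : forall x, (\int[law x]_w (tau w `^ p) <= (G x)%:E)%E.
Hypothesis tau_BB : forall w, (tau w < +oo)%E -> BB (mf_proc E (fine (tau w)) w).
Hypothesis sg_inf : forall x, BB x ->
  (delta%:E <= law x [set w | sg w = +oo])%E.
Hypothesis sg_moment : forall x, BB x ->
  (\int[law x]_(w in fin sg) (sg w `^ p) <= c%:E)%E.
Hypothesis sg_weight : forall x, BB x ->
  (\int[law x]_(w in fin sg) (G (mf_proc E (fine (sg w)) w))%:E <= K%:E)%E.

Let tauT w : tau w = +oo%E \/ exists2 t, time_plus T t & tau w = t%:E.
Proof. by have [+ _ _ _] := rtau; exact. Qed.

Let sgT w : sg w = +oo%E \/ exists2 t, time_plus T t & sg w = t%:E.
Proof. by have [+ _ _ _] := rsg; exact. Qed.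

Lemma regular_fin_measurable t : regular_time E t -> measurable (fin t).
Proof.
move=> [_ mt _ _]; rewrite -[X in measurable X]setTI.
exact: emeasurable_fun_infty_o.
Qed.

Lemma regular_fine t w : regular_time E t -> time_plus T (fine (t w)).
Proof.
by move=> [+ _ _ _] => /(_ w) [->|[s sT ->]] //=; exact: time_plus0.
Qed.

Lemma regular_integral t x (h : Omega -> \bar R) : regular_time E t ->
  (forall w, 0 <= h w)%E -> measurable_fun setT h ->
  (\int[law x]_(w in fin t) h (restart t w) =
   \int[law x]_(w in fin t) \int[law (mf_proc E (fine (t w)) w)]_v h v)%E.
Proof.
move=> rt h0 mh; have [tT mt ms smp] := rt.
transitivity (\int[law x]_(w in fin t)
    \int[law (mf_proc E 0 (restart t w))]_v h v)%E; last first.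
  by apply: eq_integral => w _; rewrite proc0_shift_at.
apply: (@ge0_integral_mixture _ _ _ _ _ (law x) (fin t) (restart t)
  (fun w => law (mf_proc E 0 (restart t w)))) => //.
- exact: regular_fin_measurable.
- move=> U mU.
  exact: measurableT_comp (law_proc_measurable E (time_plus0 hT) mU) ms.
- by move=> U mU; exact: smp.
Qed.

Let mfin_tau := regular_fin_measurable rtau.
Let mfin_sg := regular_fin_measurable rsg.
Let m_tau : measurable_fun setT tau. Proof. by have [] := rtau. Qed.
Let m_sg : measurable_fun setT sg. Proof. by have [] := rsg. Qed.
Let m_rtau : measurable_fun setT (restart tau). Proof. by have [] := rtau. Qed.
Let m_rsg : measurable_fun setT (restart sg). Proof. by have [] := rsg. Qed.

Definition step (w : Omega) : Omega := restart sg (restart tau w).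

Definition cycle : set Omega := fin tau `&` restart tau @^-1` fin sg.

Lemma step_measurable : measurable_fun setT step.
Proof. exact: measurableT_comp m_rsg m_rtau. Qed.

Let mpre (f : Omega -> Omega) A : measurable_fun setT f -> measurable A ->
  measurable (f @^-1` A).
Proof. by move=> mf mA; rewrite -[X in measurable X]setTI; exact: mf. Qed.

Lemma cycle_measurable : measurable cycle.
Proof. by apply: measurableI => //; exact: mpre. Qed.

Lemma law_fin_sg x : BB x -> (law x (fin sg) <= (1 - delta)%:E)%E.
Proof.
move=> Bx; have mi : measurable [set w | sg w = +oo%E].
  by have := m_sg measurableT (emeasurable_set1 +oo%E); rewrite setTI.
have -> : fin sg = ~` [set w | sg w = +oo%E].
  apply/seteqP; split=> w /=; first by move=> /[swap] ->.
  by move=> /eqP; rewrite ltey.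
by rewrite pkernel_setC // EFinB leeB // sg_inf.
Qed.

(** The state at [tau] lies in [BB], so a bound valid for starts in [BB] survives, integrated over
    an event of mass at most 1. *)
Lemma restart_tau_bound x (h : Omega -> \bar R) (m : R) : 0 <= m ->
  (forall w, 0 <= h w)%E -> measurable_fun setT h ->
  (forall y, BB y -> (\int[law y]_w h w <= m%:E)%E) ->
  (\int[law x]_(w in fin tau) h (restart tau w) <= m%:E)%E.
Proof.
move=> m0 h0 mh hm; rewrite regular_integral //.
apply: le_trans (_ : (\int[law x]_(w in fin tau) (cst m%:E) w <= _)%E).
  apply: ge0_le_integral => //.
  - by move=> w _; apply: integral_ge0.
  - apply: measurable_funTS.
    have -> : (fun w => \int[law (mf_proc E (fine (tau w)) w)]_v h v)%E =
       (fun y => \int[law y]_v h v)%E \o (mf_proc E 0 \o restart tau).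
      by apply/funext => w /=; rewrite proc0_shift_at.
    apply: measurableT_comp.
      by apply: measurable_fun_integral_kernel => // U mU; exact: measurable_kernel.
    by apply: measurableT_comp => //; apply: proc_measurable; exact: time_plus0.
  - by move=> w tw; apply: hm; exact: tau_BB.
rewrite integral_cst // -[leRHS]mule1 lee_wpmul2l ?lee_fin //.
exact: pkernel_le1.
Qed.

(** The engine of all inductions on the number of cycles. The constant [a] is multiplied by the
    probability, at most [1 - delta], that the squeezing fails; the weight at the moment of failure
    has expectation at most [K]. The new bound no longer depends on the starting point. *)
Lemma cycle_bound (f : Omega -> R) (a b : R) : 0 <= a -> 0 <= b ->
  (forall w, 0 <= f w) -> measurable_fun setT f ->
  (forall y, (\int[law y]_w (f w)%:E <= (a + b * G y)%:E)%E) ->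
  forall x, (\int[law x]_w (\1_cycle w * f (step w))%:E <=
    (a * (1 - delta) + b * K)%:E)%E.
Proof.
move=> a0 b0 f0 mf fab x.
pose h v := (\1_(fin sg) v * f (restart sg v))%:E.
have mf' : measurable_fun setT (f \o restart sg) by exact: measurableT_comp.
have mh : measurable_fun setT h.
  by apply/measurable_EFinP; apply: measurable_funM => //; exact: measurable_indic.
have h0 v : (0 <= h v)%E by rewrite lee_fin mulr_ge0.
have -> : (\int[law x]_w (\1_cycle w * f (step w))%:E =
    \int[law x]_(w in fin tau) h (restart tau w))%E.
  rewrite [RHS]integral_mkcond; apply: eq_integral => w _.
  rewrite patchE /h /cycle /step !indicE in_setI.
  by case: (w \in fin tau) => /=; rewrite ?mul0r // !inE.
apply: restart_tau_bound => // [|y By].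
  by rewrite addr_ge0 // mulr_ge0 // subr_ge0 ltW.
rewrite integral_indicM.
have mf'' : measurable_fun setT (EFin \o f) by exact/measurable_EFinP.
rewrite (@regular_integral sg y (EFin \o f)) //.
have mGp : measurable_fun setT (fun w => G (mf_proc E (fine (sg w)) w)).
  have -> : (fun w => G (mf_proc E (fine (sg w)) w)) = G \o (mf_proc E 0 \o restart sg).
    by apply/funext => w /=; rewrite proc0_shift_at.
  apply: measurableT_comp => //.
  by apply: measurableT_comp => //; apply: proc_measurable; exact: time_plus0.
have G0 z : 0 <= G z by apply: le_trans (G1 z).
apply: le_trans (_ : (\int[law y]_(w in fin sg)
    (a%:E + b%:E * (G (mf_proc E (fine (sg w)) w))%:E) <= _)%E).
  apply: ge0_le_integral => //.
  - by move=> w _; apply: integral_ge0 => v _; rewrite lee_fin.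
  - apply: measurable_funTS.
    have -> : (fun w => \int[law (mf_proc E (fine (sg w)) w)]_v (EFin \o f) v)%E =
       (fun y => \int[law y]_v (EFin \o f) v)%E \o (mf_proc E 0 \o restart sg).
      by apply/funext => w /=; rewrite proc0_shift_at.
    apply: measurableT_comp.
      by apply: measurable_fun_integral_kernel => // U mU; exact: measurable_kernel.
    by apply: measurableT_comp => //; apply: proc_measurable; exact: time_plus0.
  - apply/measurable_funTS/measurable_EFinP.
    by apply: measurable_funD => //; exact: measurable_funM.
rewrite ge0_integralD //; last 2 first.
- by move=> w _; rewrite -EFinM lee_fin mulr_ge0.
- by apply/measurable_funTS/measurable_EFinP; exact: measurable_funM.
rewrite integral_cst // ge0_integralZl //; last 2 first.
- by apply/measurable_funTS/measurable_EFinP.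
- by move=> w _; rewrite lee_fin.
rewrite EFinD; apply: leeD.
  by rewrite EFinM lee_wpmul2l ?lee_fin // law_fin_sg.
by rewrite EFinM lee_wpmul2l ?lee_fin // sg_weight.
Qed.

(* [reach k]: the first [k] cycles are completed; [good k]: moreover the next one
   never fails; [settle k]: the time at which it begins, made total by
   [fine +oo = 0].  Peeling cycles off from the front means that the strong
   Markov property is only needed at [tau] and [sg], not at compound times. *)
Fixpoint reach k : set Omega :=
  if k is j.+1 then cycle `&` step @^-1` reach j else setT.

Fixpoint good k : set Omega :=
  if k is j.+1 then cycle `&` step @^-1` good j
  else fin tau `&` restart tau @^-1` [set w | sg w = +oo%E].

Fixpoint settle k w : R :=
  if k is j.+1 then fine (tau w) + fine (sg (restart tau w)) + settle j (step w)
  else fine (tau w).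

Lemma settle_time k w : time_plus T (settle k w).
Proof.
elim: k w => [|k IHk] w /=; first exact: regular_fine.
apply: (time_plusD hT) (IHk _).
by apply: (time_plusD hT); exact: regular_fine.
Qed.

Lemma settle_ge0 k w : 0 <= settle k w.
Proof. by have [] := settle_time k w. Qed.

Lemma good_settle k w : good k w -> sg (mf_shift E (settle k w) w) = +oo%E.
Proof.
elim: k w => [|k IHk] w /=; first by case.
move=> [_ /IHk]; rewrite /step /shift_at -mf_shiftD;
  [|exact: settle_time|exact: regular_fine].
rewrite -mf_shiftD; first last.
- exact: regular_fine.
- by apply: (time_plusD hT); [exact: settle_time|exact: regular_fine].
by rewrite -addrA addrC (addrC (fine (sg _))).
Qed.

Lemma good_reach k : good k `<=` reach k.
Proof. by elim: k => [|k IHk] w //= [cw /IHk]. Qed.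

Lemma good_inj j k w : good j w -> good k w -> j = k.
Proof.
elim: j k w => [|j IHj] [|k] w //=.
- by move=> [_ /= sw] [[_ /=]]; rewrite sw.
- by move=> [[_ /= +] _] [_ /= sw]; rewrite sw.
- by move=> [_ gj] [_ gk]; congr _.+1; exact: IHj gj gk.
Qed.

Lemma reach_measurable k : measurable (reach k).
Proof.
elim: k => //= k IHk; apply: measurableI; first exact: cycle_measurable.
by apply: mpre => //; exact: step_measurable.
Qed.

Lemma good_measurable k : measurable (good k).
Proof.
elim: k => /= [|k IHk]; apply: measurableI => //.
- apply: mpre => //.
  by have := m_sg measurableT (emeasurable_set1 +oo%E); rewrite setTI.
- exact: cycle_measurable.
- by apply: mpre => //; exact: step_measurable.
Qed.

Let m_ftau : measurable_fun setT (fun w => fine (tau w)).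
Proof. exact: measurableT_comp. Qed.

Let m_fsg : measurable_fun setT (fun w => fine (sg w)).
Proof. exact: measurableT_comp. Qed.

Lemma settle_measurable k : measurable_fun setT (settle k).
Proof.
elim: k => //= k IHk; apply: measurable_funD.
  by apply: measurable_funD => //; exact: measurableT_comp m_fsg m_rtau.
exact: measurableT_comp IHk step_measurable.
Qed.

Lemma indic_reachS k w : \1_(reach k.+1) w = \1_cycle w * \1_(reach k) (step w) :> R.
Proof.
rewrite /= !indicE in_setI.
have -> : (w \in step @^-1` reach k) = (step w \in reach k) by [].
by case: (w \in cycle); rewrite ?mul1r ?mul0r.
Qed.

Lemma reach_prob k x : (\int[law x]_w (\1_(reach k) w)%:E <= ((1 - delta) ^+ k)%:E)%E.
Proof.
have d0 : 0 <= 1 - delta by rewrite subr_ge0 ltW.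
elim: k x => [|k IHk] x.
  rewrite integral_indic //; last exact: (reach_measurable 0).
  by rewrite expr0; apply: pkernel_le1; rewrite setIT; exact: (reach_measurable 0).
under eq_integral do rewrite indic_reachS.
have := @cycle_bound (\1_(reach k)) ((1 - delta) ^+ k) 0 _ _ _ _ _ x.
rewrite mul0r addr0 -exprSr; apply => //.
- exact: exprn_ge0.
- exact/measurable_indic/reach_measurable.
- by move=> y; rewrite mul0r addr0.
Qed.

Lemma fine_powR (z : \bar R) : (0 <= z -> ((fine z) `^ p)%:E <= z `^ p)%E.
Proof.
case: z => [r _|_|//]; first by rewrite poweR_EFin.
by rewrite poweRyr ?lt0r_neq0 // leey.
Qed.

Let ftau_moment x : (\int[law x]_w ((fine (tau w)) `^ p)%:E <= (G x)%:E)%E.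
Proof.
apply: le_trans (tau_moment x); apply: ge0_le_integral => //.
- by move=> w _; rewrite lee_fin powR_ge0.
- apply/measurable_EFinP.
  exact: measurableT_comp (measurable_powR _) m_ftau.
- exact: measurableT_comp (measurable_poweR _) m_tau.
- move=> w _; apply: fine_powR.
  by case: (tauT w) => [->//|[t [_ t0] ->]].
Qed.

Let fsg_moment x :
  (\int[law x]_w (\1_cycle w * (fine (sg (restart tau w))) `^ p)%:E <= c%:E)%E.
Proof.
pose h v := (\1_(fin sg) v * (fine (sg v)) `^ p)%:E.
have mf : measurable_fun setT (fun v => (fine (sg v)) `^ p).
  exact: measurableT_comp (measurable_powR _) m_fsg.
have mh : measurable_fun setT h.
  by apply/measurable_EFinP; apply: measurable_funM => //; exact: measurable_indic.
have h0 v : (0 <= h v)%E by rewrite lee_fin mulr_ge0 // powR_ge0.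
have -> : (\int[law x]_w (\1_cycle w * (fine (sg (restart tau w))) `^ p)%:E =
    \int[law x]_(w in fin tau) h (restart tau w))%E.
  rewrite [RHS]integral_mkcond; apply: eq_integral => w _.
  rewrite patchE /h /cycle !indicE in_setI.
  by case: (w \in fin tau) => /=; rewrite ?mul0r // !inE.
apply: restart_tau_bound => // y By.
rewrite integral_indicM; apply: le_trans (sg_moment By).
apply: ge0_le_integral => //.
- by move=> w _; rewrite lee_fin powR_ge0.
- exact/measurable_funTS/measurable_EFinP.
- exact/measurable_funTS/(measurableT_comp (measurable_poweR _) m_sg).
- move=> w _; apply: fine_powR.
  by case: (sgT w) => [->//|[t [_ t0] ->]].
Qed.

(* The factor [1 + delta] lost on the remaining cycles is compensated by the
   probability [1 - delta] of completing the first one, so that the bound is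
   uniform in [k]. *)
Lemma settle_moment : exists2 A, 0 < A & forall k x,
  (\int[law x]_w (\1_(reach k) w * settle k w `^ p)%:E <= (A * G x)%:E)%E.
Proof.
have [C C0 hC] := powR_add_eps p0 delta0.
(* [b] is at least 1 for the case without cycles, and at least C 2^p to absorb the term in [tau].
   [a] is the fixed point of the recursion for the constant term, verified in [aE]; its denominator
   comes from (1 + delta) (1 - delta) = 1 - delta^2. *)
pose b := Num.max 1 (C * 2 `^ p).
pose a := ((1 + delta) * (b * K) + C * 2 `^ p * c) / delta ^+ 2.
have C2 : 0 <= C * 2 `^ p by rewrite mulr_ge0 ?powR_ge0 // ltW.
have b1 : 1 <= b by rewrite /b le_max lexx.
have bC : C * 2 `^ p <= b by rewrite /b le_max lexx orbT.
have a0 : 0 <= a.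
  apply: divr_ge0 (exprn_ge0 _ (ltW delta0)).
  apply: addr_ge0 (mulr_ge0 C2 c0).
  by rewrite !mulr_ge0 ?addr_ge0 ?(le_trans ler01 b1) // ltW.
have aE : (1 + delta) * (a * (1 - delta) + b * K) + C * 2 `^ p * c = a.
  rewrite /a; field; exact: lt0r_neq0.
suff H k x : (\int[law x]_w (\1_(reach k) w * settle k w `^ p)%:E <=
    (a + b * G x)%:E)%E.
  exists (a + b) => [|k x]; first lra.
  apply: le_trans (H k x) _.
  by rewrite lee_fin mulrDl lerD2r ler_peMr.
elim: k x => [|k IHk] x.
  apply: le_trans (_ : (\int[law x]_w ((fine (tau w)) `^ p)%:E <= _)%E).
    by rewrite le_eqVlt; apply/orP; left; apply/eqP; apply: eq_integral => w _;
      rewrite indicT mul1r.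
  apply: le_trans (ftau_moment x) _; rewrite lee_fin.
  have := G1 x; nra.
(* The three contributions are the later cycles, [tau] and [sg]. The later cycles are the first
   argument of [powR_add_eps], so that only [tau] and [sg] receive the large constant. *)
pose f1 w := (1 + delta) * (\1_cycle w * (\1_(reach k) (step w) * settle k (step w) `^ p)).
pose f2 w := C * 2 `^ p * (fine (tau w)) `^ p.
pose f3 w := C * 2 `^ p * (\1_cycle w * (fine (sg (restart tau w))) `^ p).
have msk : measurable_fun setT (fun w => \1_(reach k) w * settle k w `^ p).
  apply: measurable_funM; first exact/measurable_indic/reach_measurable.
  exact: measurableT_comp (measurable_powR _) (settle_measurable k).
have m1c : measurable_fun setT (\1_cycle : Omega -> R).
  exact/measurable_indic/cycle_measurable.
have mf1' : measurable_fun setT (fun w => \1_cycle w * (\1_(reach k) (step w) * settle k (step w) `^ p)).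
  by apply: measurable_funM => //; exact: measurableT_comp msk step_measurable.
have mf2' : measurable_fun setT (fun w => (fine (tau w)) `^ p).
  exact: measurableT_comp (measurable_powR _) m_ftau.
have mf3' : measurable_fun setT (fun w => \1_cycle w * (fine (sg (restart tau w))) `^ p).
  apply: measurable_funM => //.
  apply: measurableT_comp (measurable_powR _) _.
  exact: measurableT_comp m_fsg m_rtau.
have mf1 : measurable_fun setT f1 by exact: measurable_funM.
have mf2 : measurable_fun setT f2 by exact: measurable_funM.
have mf3 : measurable_fun setT f3 by exact: measurable_funM.
have d1 : 0 <= 1 + delta by rewrite addr_ge0 // ltW.
have f10 w : 0 <= f1 w by rewrite /f1 !mulr_ge0 ?powR_ge0.
have f20 w : 0 <= f2 w by rewrite /f2 mulr_ge0 ?powR_ge0.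
have f30 w : 0 <= f3 w by rewrite /f3 !mulr_ge0 ?powR_ge0 // ltW.
apply: le_trans (_ : (\int[law x]_w ((f1 w)%:E + (f2 w)%:E + (f3 w)%:E) <= _)%E).
  apply: ge0_le_integral => //.
  - by move=> w _; rewrite lee_fin mulr_ge0 ?powR_ge0.
  - apply/measurable_EFinP; apply: measurable_funM.
      exact/measurable_indic/reach_measurable.
    exact: measurableT_comp (measurable_powR _) (settle_measurable k.+1).
  - by apply/measurable_EFinP; do 2?apply: measurable_funD.
  move=> w _; rewrite -!EFinD lee_fin indic_reachS.
  rewrite /f1 /f3 indicE; case: (w \in cycle); last first.
    by rewrite !mul0r !mulr0 add0r addr0.
  rewrite !mul1r; rewrite indicE; case: (step w \in _); last first.
    by rewrite !mul0r mulr0 add0r addr_ge0 // mulr_ge0 ?powR_ge0.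
  rewrite !mul1r /= [X in X `^ p <= _]addrC.
  have t0 : 0 <= fine (tau w) by have [] := regular_fine w rtau.
  have s0 : 0 <= fine (sg (restart tau w)) by have [] := regular_fine (restart tau w) rsg.
  apply: le_trans (hC _ _ (settle_ge0 k (step w)) (addr_ge0 t0 s0)) _.
  rewrite -addrA lerD2l /f2 -mulrDr -mulrA.
  by apply: ler_wpM2l; [exact: ltW|exact: powR_add_le].
rewrite ge0_integralD //; last 4 first.
- by move=> w _; rewrite -EFinD lee_fin addr_ge0.
- by apply/measurable_EFinP; exact: measurable_funD.
- by move=> w _; rewrite lee_fin.
- exact/measurable_EFinP.
rewrite ge0_integralD //; last 4 first.
- by move=> w _; rewrite lee_fin.
- exact/measurable_EFinP.
- by move=> w _; rewrite lee_fin.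
- exact/measurable_EFinP.
have -> : (a + b * G x)%:E = (((1 + delta)%:E * (a * (1 - delta) + b * K)%:E +
    (b * G x)%:E) + (C * 2 `^ p)%:E * c%:E)%E.
  by rewrite -!EFinM -!EFinD -[in LHS]aE; congr EFin; ring.
apply: leeD; first apply: leeD.
- under eq_integral do rewrite EFinM.
  rewrite ge0_integralZl ?lee_fin //; last 2 first.
  - exact/measurable_EFinP.
  - by move=> w _; rewrite lee_fin !mulr_ge0 ?powR_ge0.
  apply: lee_wpmul2l; first by rewrite lee_fin.
  apply: (@cycle_bound (fun w => \1_(reach k) w * settle k w `^ p)) => //.
  + lra.
  + by move=> w; rewrite mulr_ge0 ?powR_ge0.
- under eq_integral do rewrite EFinM.
  rewrite ge0_integralZl ?lee_fin //; last 2 first.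
  - exact/measurable_EFinP.
  - by move=> w _; rewrite lee_fin powR_ge0.
  apply: le_trans (_ : (b%:E * (G x)%:E <= _)%E) => //.
  apply: lee_pmul; rewrite ?lee_fin //.
  by apply: integral_ge0 => w _; rewrite lee_fin powR_ge0.
- under eq_integral do rewrite EFinM.
  rewrite ge0_integralZl ?lee_fin //; last 2 first.
  - exact/measurable_EFinP.
  - by move=> w _; rewrite lee_fin mulr_ge0 ?powR_ge0.
  by apply: lee_wpmul2l; rewrite ?lee_fin.
Qed.

Let tau_inf_null x : law x [set w | tau w = +oo%E] = 0%E.
Proof.
have mtp : measurable_fun setT (fun w => tau w `^ p)%E.
  exact: measurableT_comp (measurable_poweR _) m_tau.
have itau : (law x).-integrable setT (fun w => tau w `^ p)%E.
  apply/integrableP; split => //; apply: le_lt_trans (ltry (G x)).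
  apply: le_trans (tau_moment x); rewrite le_eqVlt; apply/orP; left; apply/eqP.
  by apply: eq_integral => w _; rewrite gee0_abs // poweR_ge0.
have mi : measurable [set w | tau w = +oo%E].
  by have := m_tau measurableT (emeasurable_set1 +oo%E); rewrite setTI.
apply/negligibleP => //; have := integrable_ae measurableT itau.
apply: negligibleS => w /= tw; apply/existsNP; exists I.
by rewrite tw poweRyr // lt0r_neq0.
Qed.

Definition never : set Omega := \bigcap_k ~` good k.

Lemma never_measurable : measurable never.
Proof. by apply: bigcapT_measurable => k; apply/measurableC/good_measurable. Qed.

(** Outside the null event that [tau] is infinite, a trajectory in [never] completes a cycle and is
    again in [never] after it. Each round costs a factor [1 - delta], for any number of rounds. *)
Lemma never_null x : law x never = 0%E.
Proof.
have mi : measurable [set w | tau w = +oo%E].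
  by have := m_tau measurableT (emeasurable_set1 +oo%E); rewrite setTI.
have mn := never_measurable; have mc := cycle_measurable.
have ms : measurable (cycle `&` step @^-1` never).
  by apply: measurableI => //; apply: mpre => //; exact: step_measurable.
have d0 : 0 <= 1 - delta by rewrite subr_ge0 ltW.
have H k y : (law y never <= ((1 - delta) ^+ k)%:E)%E.
  elim: k y => [|k IHk] y; first by rewrite expr0; exact: pkernel_le1.
  apply: le_trans (_ : (law y ([set w | tau w = +oo%E] `|`
      (cycle `&` step @^-1` never)) <= _)%E).
    apply: le_measure; rewrite ?inE //; first exact: measurableU.
    move=> w nw; case: (tauT w) => [tw|[t tT tw]]; [by left|right].
    have tfin : (tau w < +oo)%E by rewrite tw ltry.
    have cw : cycle w.
      split=> //=; case: (sgT (restart tau w)) => [sw|[s sT ->]]; last exact: ltry.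
      by have := nw 0%N I; case.
    by split=> // j _ /= gj; apply: (nw j.+1 I).
  apply: le_trans (measureU2 _ _ _) _ => //.
  rewrite [X in (X + _)%E]tau_inf_null add0e.
  have := @cycle_bound (\1_never) ((1 - delta) ^+ k) 0 _ _ _ _ _ y.
  rewrite mul0r addr0 -exprSr => h.
  apply: le_trans (h _ _ _ _ _) => //.
  - rewrite le_eqVlt; apply/orP; left; apply/eqP.
    transitivity (\int[law y]_w (\1_(cycle `&` step @^-1` never) w)%:E)%E.
      by rewrite integral_indic // setIT.
    apply: eq_integral => w _; congr EFin; rewrite !indicE in_setI.
    have -> : (w \in step @^-1` never) = (step w \in never) by [].
    by case: (w \in cycle); rewrite ?mul1r ?mul0r.
  - exact: exprn_ge0.
  - by move=> z; rewrite mul0r addr0 integral_indic // setIT.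
apply/eqP; rewrite eq_le measure_ge0 andbT.
have cv : ((1 - delta) ^+ k)%:E @[k --> \oo] --> (0 : R)%:E.
  by apply: cvg_EFin; [exact: nearW|apply: cvg_expr; rewrite ger0_norm // gtrBl].
by apply: (cvge_to_ge cv); apply: nearW.
Qed.

(** On [never] the default index 0 selects [settle 0]. As [reach 0] is everything, the pointwise
    bound by a series in [regen_moment] holds there too. *)
Definition regen w : R := settle (xget 0%N [set k | good k w]) w.

Lemma regen_good k w : good k w -> regen w = settle k w.
Proof.
move=> gk; rewrite /regen; case: xgetP => [j _ gj|/(_ k)//].
by rewrite (good_inj gj gk).
Qed.

Lemma regen_never w : never w -> regen w = settle 0 w.
Proof.
by move=> nw; rewrite /regen; case: xgetP => [j _ gj|//]; have := nw j I.
Qed.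

Lemma regen_time w : time_plus T (regen w).
Proof. exact: settle_time. Qed.

Lemma regen_spec w : ~ never w -> sg (mf_shift E (regen w) w) = +oo%E.
Proof.
move=> /existsNP[k /not_implyP[_ /contrapT gk]].
by rewrite (regen_good gk); exact: good_settle.
Qed.

Lemma regen_measurable : measurable_fun setT regen.
Proof.
move=> _ A mA; rewrite setTI.
have -> : regen @^-1` A = \bigcup_k (good k `&` settle k @^-1` A) `|`
    (never `&` settle 0 @^-1` A).
  apply/seteqP; split=> w /=.
    have [nw|/existsNP[k /not_implyP[_ /contrapT gk]]] := pselect (never w).
      by rewrite (regen_never nw) => ?; right.
    by rewrite (regen_good gk) => ?; left; exists k.
  move=> [[k _ [gk]]|[nw]] /=; first by rewrite (regen_good gk).
  by rewrite (regen_never nw).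
have ms k : measurable (settle k @^-1` A).
  by rewrite -[X in measurable X]setTI; exact: settle_measurable.
apply: measurableU.
  by apply: bigcupT_measurable => k; apply: measurableI => //; exact: good_measurable.
by apply: measurableI => //; exact: never_measurable.
Qed.

(** By [powR_young] with weight [s ^+ k], the k-th candidate contributes at most s^k times its p-th
    moment on [reach k], which is bounded in k, plus u^k times the probability of [reach k]. Both
    series are geometric when s < 1 and u (1 - delta) < 1. *)
Theorem regen_moment (p1 : R) : 0 < p1 -> p1 < p -> exists2 A, 0 < A &
  forall x, (\int[law x]_w (regen w `^ p1)%:E <= (A * G x)%:E)%E.
Proof.
move=> p10 p1p; have [A A0 HA] := settle_moment.
have [dpos dlt1] := (delta0, delta1).
have pp1 : 0 < p - p1 by rewrite subr_gt0.
pose a := p1 / (p - p1); have a0 : 0 < a by rewrite divr_gt0.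
(* [u] exceeds 1 and still satisfies u (1 - delta) < 1; [s] is then determined by s^(-a) = u, where
   [-a] is the exponent in [powR_young]. *)
pose u := (1 - delta / 2)^-1; have d20 : 0 < 1 - delta / 2 by lra.
have u0 : 0 < u by rewrite invr_gt0.
have u1 : 1 < u by rewrite invf_gt1 //; lra.
pose s := u `^ (- a^-1).
have s0 : 0 < s by rewrite powR_gt0.
have sa : s `^ (- a) = u.
  by rewrite /s -powRrM mulrNN mulVf ?lt0r_neq0 // powRr1 // ltW.
have s1 : s < 1.
  rewrite ltNge; apply/negP => s1.
  have : s `^ (- a) <= s `^ 0 by apply: ler_powR => //; rewrite oppr_le0 ltW.
  by rewrite sa powRr0 leNgt u1.
have sE k : (s ^+ k) `^ (- a) = u ^+ k.
  rewrite -sa -(powR_mulrn k (ltW s0)) -(powR_mulrn k (powR_ge0 s (- a))).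
  exact: powRAC.
have ud : u * (1 - delta) < 1 by rewrite mulrC ltr_pdivrMr // mul1r; lra.
have d0 : 0 <= 1 - delta by lra.
have ud0 : 0 <= u * (1 - delta) by rewrite mulr_ge0 // ltW.
pose f k w := s ^+ k * (\1_(reach k) w * settle k w `^ p) + u ^+ k * \1_(reach k) w.
have mi k : measurable_fun setT (\1_(reach k) : Omega -> R).
  exact/measurable_indic/reach_measurable.
have msk k : measurable_fun setT (fun w => \1_(reach k) w * settle k w `^ p).
  apply: measurable_funM => //.
  exact: measurableT_comp (measurable_powR _) (settle_measurable k).
have f0 k w : 0 <= f k w.
  by rewrite addr_ge0 ?mulr_ge0 ?exprn_ge0 ?powR_ge0 // ltW.
have mf k : measurable_fun setT (f k).
  by apply: measurable_funD; exact: measurable_funM.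
have settle_f k w : reach k w -> settle k w `^ p1 <= f k w.
  move=> rk; rewrite /f indicE mem_set // mul1r mulr1 -sE.
  by apply: powR_young => //; [exact: settle_ge0|exact: exprn_gt0].
have regen_f w : ((regen w `^ p1)%:E <= \sum_(k <oo) (f k w)%:E)%E.
  have [k rk ->] : exists2 k, reach k w & regen w = settle k w.
    have [nw|/existsNP[k /not_implyP[_ /contrapT gk]]] := pselect (never w).
      by exists 0%N => //; rewrite (regen_never nw).
    by exists k; [exact: good_reach|exact: regen_good].
  apply: le_trans (_ : ((f k w)%:E <= _)%E); first by rewrite lee_fin settle_f.
  apply: le_trans (nneseries_lim_ge k.+1 _); last by move=> *; rewrite lee_fin.
  rewrite big_nat_recr //= leeDr // sume_ge0 // => i _; by rewrite lee_fin.
pose A' := A / (1 - s) + (1 - u * (1 - delta))^-1.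
have s1' : 0 < 1 - s by rewrite subr_gt0.
have ud' : 0 < 1 - u * (1 - delta) by rewrite subr_gt0.
exists A' => [|x]; first by rewrite addr_gt0 ?divr_gt0 ?invr_gt0.
apply: le_trans (_ : (\int[law x]_w \sum_(k <oo) (f k w)%:E <= _)%E).
  apply: ge0_le_integral => //.
  - by move=> w _; rewrite lee_fin powR_ge0.
  - apply/measurable_EFinP.
    exact: measurableT_comp (measurable_powR _) regen_measurable.
  - apply: ge0_emeasurable_sum => [k w _ _|k _]; first by rewrite lee_fin.
    exact/measurable_EFinP.
rewrite integral_nneseries //; last 2 first.
- by move=> k; exact/measurable_EFinP.
- by move=> k w _; rewrite lee_fin.
apply: lime_le.
  by apply: is_cvg_nneseries => k _ _; apply: integral_ge0 => w _; rewrite lee_fin.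
apply: nearW => n; rewrite big_mkord.
have Gx0 : 0 <= G x by apply: le_trans (G1 x).
have fint k : (\int[law x]_w (f k w)%:E <=
    (s ^+ k * (A * G x) + (u * (1 - delta)) ^+ k)%:E)%E.
  under eq_integral do rewrite /f EFinD.
  rewrite ge0_integralD //; last 4 first.
  - by move=> w _; rewrite lee_fin !mulr_ge0 ?exprn_ge0 ?powR_ge0 // ltW.
  - by apply/measurable_EFinP; exact: measurable_funM.
  - by move=> w _; rewrite lee_fin !mulr_ge0 ?exprn_ge0 // ltW.
  - by apply/measurable_EFinP; exact: measurable_funM.
  rewrite EFinD; apply: leeD.
    under eq_integral do rewrite EFinM.
    rewrite ge0_integralZl //; last 3 first.
    - exact/measurable_EFinP.
    - by move=> w _; rewrite lee_fin mulr_ge0 ?powR_ge0.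
    - by rewrite lee_fin exprn_ge0 // ltW.
    by rewrite EFinM lee_wpmul2l ?lee_fin ?exprn_ge0 // ltW.
  under eq_integral do rewrite EFinM.
  rewrite ge0_integralZl //; last 2 first.
  - exact/measurable_EFinP.
  - by rewrite lee_fin exprn_ge0 // ltW.
  rewrite exprMn EFinM; apply: lee_wpmul2l; last exact: reach_prob.
  by rewrite lee_fin exprn_ge0 // ltW.
apply: le_trans (_ : (\sum_(k < n)
    (s ^+ k * (A * G x) + (u * (1 - delta)) ^+ k)%:E <= _)%E).
  by apply: lee_sum => k _; exact: fint.
rewrite sumEFin lee_fin big_split /= -mulr_suml /A' mulrDl.
apply: lerD.
  apply: le_trans (_ : (1 - s)^-1 * (A * G x) <= _).
    apply: ler_wpM2r; first by rewrite mulr_ge0 // ltW.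
    exact: geometric_sum_le (ltW s0) s1.
  by rewrite mulrA [A / _]mulrC.
apply: le_trans (geometric_sum_le n ud0 ud) _.
by rewrite ler_peMr // invr_ge0 ltW.
Qed.

End Regeneration.

(** * Transition semigroups *)

Lemma pushforward_probability (R : realType) d d' (Y : measurableType d)
    (Z : measurableType d') (P : probability Y R) (phi : Y -> Z) :
  measurable_fun setT phi ->
  exists Q : probability Z R, (forall A, Q A = P (phi @^-1` A)) /\
    forall (f : Z -> R) K, measurable_fun setT f -> (forall z, `|f z| <= K) ->
      \int[Q]_z f z = \int[P]_y f (phi y).
Proof.
move=> mphi.
pose phi' : {mfun Y >-> Z} := HB.pack phi (isMeasurableFun.Build _ _ _ _ _ mphi).
exists (distribution P phi'); split=> // f K mf fK.
rewrite /Rintegral integral_distribution //; first exact/measurable_EFinP.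
apply: (@bounded_integrable _ _ _ P (f \o phi) K) => [|y]; last exact: fK.
exact: measurableT_comp.
Qed.

(** Adding a bound of a function makes it nonnegative; this carries results on nonnegative
    integrands, such as [markov_integral], over to bounded ones. *)
Lemma integralD_cst (R : realType) d (Y : measurableType d)
    (P : probability Y R) (f : Y -> R) (K a : R) :
  measurable_fun setT f -> (forall y, `|f y| <= K) ->
  (\int[P]_y (f y + a)%:E = (\int[P]_y f y + a)%:E)%E.
Proof.
move=> mf fK; have intf := bounded_integrable P mf fK.
have inta : P.-integrable setT (EFin \o (fun=> a)).
  by apply: (@bounded_integrable _ _ _ P _ `|a|) => //; exact: measurable_cst.
have intfa : P.-integrable setT (EFin \o (fun y => f y + a)).
  apply: (@bounded_integrable _ _ _ P _ (K + `|a|)) => [|y].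
    by apply: measurable_funD => //; exact: measurable_cst.
  by apply: le_trans (ler_normD _ _) _; exact: lerD.
transitivity ((\int[P]_y (f y + a))%:E).
  by rewrite /Rintegral fineK // integrable_fin_num.
by rewrite RintegralD // Rintegral1.
Qed.

Section MixtureProbability.
Context (R : realType) d d' (Y : measurableType d) (Z : measurableType d').
Variables (mu : probability Y R) (k : Y -> probability Z R).
Hypothesis mk : forall U, measurable U -> measurable_fun setT (fun y => k y U).

Definition mixture (U : set Z) : \bar R := (\int[mu]_y k y U)%E.

Let mixture0 : mixture set0 = 0%E.
Proof. by apply: integral0_eq => y _; rewrite measure0. Qed.

Let mixture_ge0 U : (0 <= mixture U)%E.
Proof. by apply: integral_ge0 => y _; exact: measure_ge0. Qed.

Let mixture_sigma_additive : semi_sigma_additive mixture.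
Proof.
move=> F mF tF mUF.
rewrite [X in _ --> X](_ : _ = (\int[mu]_y \sum_(n <oo) k y (F n))%E); last first.
  apply: eq_integral => y _.
  by apply/esym/cvg_lim => //; exact/measure_semi_sigma_additive.
apply/cvg_closeP; split.
  by apply: is_cvg_nneseries => n _ _; exact: integral_ge0.
by rewrite closeE // integral_nneseries // => n; exact: mk.
Qed.

HB.instance Definition _ := isMeasure.Build _ _ _ mixture
  mixture0 mixture_ge0 mixture_sigma_additive.

Let mixtureT : mixture setT = 1%E.
Proof.
transitivity (\int[mu]_y 1)%E.
  by apply: eq_integral => y _; exact: probability_setT.
by rewrite integral_cst // mul1e; exact: probability_setT.
Qed.

HB.instance Definition _ := Measure_isProbability.Build _ _ _ mixture mixtureT.

Lemma mixture_probability : exists Q : probability Z R,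
  (forall A, Q A = \int[mu]_y k y A)%E /\
  forall h : Z -> \bar R, (forall z, 0 <= h z)%E -> measurable_fun setT h ->
    (\int[Q]_z h z = \int[mu]_y \int[k y]_z h z)%E.
Proof.
exists mixture; split=> // h h0 mh.
rewrite -(@ge0_integral_mixture_eq _ _ _ _ _ _ _ mixture mu setT setT
  (fun z => \d_z) k) //.
- by apply: eq_integral => z _; rewrite integral_dirac // diracT mul1e.
- by move=> U mU; exact: measurable_fun_dirac.
- move=> U mU; transitivity (mixture U) => //.
  rewrite -[in RHS](setIT U) -integral_indic //.
Qed.

End MixtureProbability.

Section TransitionSemigroup.
Context (R : realType) (T : set R) (hT : is_time_set T).
Context d (S : measurableType d) d' (Omega : measurableType d').
Variable M : markov_family T S Omega.

Local Notation law := (mf_law M).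

Definition Pt (t : R) (f : S -> R) (u : S) : R :=
  \int[law u]_w f (mf_proc M t w).

Lemma transition_probability t u : time_plus T t ->
  exists Q : probability S R, (forall A, Q A = transition M t u A) /\
    forall (f : S -> R) K, measurable_fun setT f -> (forall z, `|f z| <= K) ->
      \int[Q]_z f z = Pt t f u.
Proof.
by move=> tT; apply: (pushforward_probability (kernel_at law u)); exact: proc_measurable.
Qed.

Lemma Pt_integral t u (f : S -> R) K : time_plus T t ->
  measurable_fun setT f -> (forall z, `|f z| <= K) ->
  (\int[transition M t u]_v (f v)%:E)%E = (Pt t f u)%:E.
Proof.
move=> tT mf fK; have mp := proc_measurable M tT.
have intf : (law u).-integrable setT (EFin \o (f \o mf_proc M t)).
  apply: (bounded_integrable (kernel_at law u) (K := K)) => [|w].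
    exact: measurableT_comp.
  exact: fK.
have mf' : measurable_fun setT (EFin \o f) by exact/measurable_EFinP.
apply: etrans (integral_pushforward mp mf' intf measurableT) _.
by rewrite preimage_setT /Pt /Rintegral fineK // integrable_fin_num.
Qed.

Section bounded.
Variables (f : S -> R) (K : R).
Hypotheses (mf : measurable_fun setT f) (fK : forall z, `|f z| <= K).

Let mfp t : time_plus T t -> measurable_fun setT (fun w => f (mf_proc M t w)).
Proof. by move=> tT; apply: measurableT_comp => //; exact: proc_measurable. Qed.

Lemma Pt_bounded t u : time_plus T t -> `|Pt t f u| <= K.
Proof.
move=> tT; have intf : (law u).-integrable setT (EFin \o (fun w => f (mf_proc M t w))).
  by apply: (bounded_integrable (kernel_at law u) (K := K)) => //; exact: mfp.
apply: le_trans (le_normr_Rintegral measurableT intf) _.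
rewrite -[leRHS](Rintegral1 (kernel_at law u)).
apply: le_Rintegral => //.
- apply: (bounded_integrable (kernel_at law u) (K := K)) => [|w]; last first.
    by rewrite normr_id.
  by apply: measurableT_comp => //; exact: mfp.
- apply: (bounded_integrable (kernel_at law u) (K := `|K|)) => //.
Qed.

Let PtD t u : time_plus T t ->
  (\int[law u]_w (f (mf_proc M t w) + K)%:E = (Pt t f u + K)%:E)%E.
Proof.
by move=> tT; apply: (integralD_cst (kernel_at law u) (K := K)) => //; exact: mfp.
Qed.

Let fD0 z : 0 <= f z + K.
Proof. by have := fK z; rewrite ler_norml => /andP[? _]; rewrite -lerBlDr sub0r. Qed.

Lemma Pt_measurable t : time_plus T t -> measurable_fun setT (Pt t f).
Proof.
move=> tT.
have -> : Pt t f = (fun u => fine (\int[law u]_w (f (mf_proc M t w) + K)%:E)%E - K).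
  by apply/funext => u; rewrite PtD //= addrK.
apply: measurable_funB; last exact: measurable_cst.
apply: measurableT_comp => //.
apply: measurable_fun_integral_kernel => [U mU|w|]; first exact: measurable_kernel.
  by rewrite lee_fin.
apply/measurable_EFinP; apply: measurable_funD; last exact: measurable_cst.
exact: mfp.
Qed.

Lemma chapman s t u : time_plus T s -> time_plus T t ->
  Pt (t + s) f u = \int[law u]_w Pt t f (mf_proc M s w).
Proof.
move=> sT tT; have tsT := time_plusD hT tT sT.
apply: (addIr K); apply: EFin_inj; rewrite -PtD //.
rewrite -(integralD_cst (kernel_at law u) (K := K)); last 2 first.
- by apply: measurableT_comp (Pt_measurable tT) _; exact: proc_measurable.
- by move=> w; exact: Pt_bounded.
under [RHS]eq_integral do rewrite -PtD //.
have mh : measurable_fun setT (fun w => (f (mf_proc M t w) + K)%:E).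
  apply/measurable_EFinP; apply: measurable_funD; last exact: measurable_cst.
  exact: mfp.
rewrite -(markov_integral M u sT _ mh); last by move=> w; rewrite lee_fin.
by apply: eq_integral => w _; rewrite mf_proc_shift.
Qed.

End bounded.
End TransitionSemigroup.

(** * Decay of the coupled distance *)

Lemma measurable_weight_norm (R : realType) (X : completeNormedModType R)
    (g : R -> R) :
  weight g -> measurable_fun setT (fun u : borel X => g `|u : X|).
Proof.
(* [g] is monotone for nonnegative arguments; the cut-off at 0 makes it monotone on the whole line
   without changing its values at norms. *)
move=> [gnd _]; pose g' r := g (Num.max 0 r).
rewrite (_ : (fun u => _) = g' \o (fun u : borel X => `|u : X|)); last first.
  by apply/funext => u; rewrite /g' /= max_r.
apply: measurableT_comp; last first.
  by apply: borel_continuous => x; apply: cvg_norm; exact: cvg_id.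
apply: nondecreasing_measurable => // r s rs; rewrite /g'; apply: gnd.
  by rewrite le_max lexx.
by rewrite ge_max !le_max lexx rs orbT.
Qed.

Lemma measurable_pair_weight (R : realType) (X : completeNormedModType R)
    (g : R -> R) : weight g ->
  measurable_fun setT (fun x : (borel X * borel X)%type => pair_weight g (x : X * X)).
Proof.
move=> wg; apply: measurable_funD.
  exact: measurableT_comp (measurable_weight_norm wg) measurable_fst.
exact: measurableT_comp (measurable_weight_norm wg) measurable_snd.
Qed.

Lemma pair_weight_ge1 (R : realType) (X : completeNormedModType R) (g : R -> R)
    (x : X * X) : weight g -> 1 <= pair_weight g x.
Proof.
move=> [_ g1]; rewrite /pair_weight.
by have := g1 `|x.1| (normr_ge0 _); have := g1 `|x.2| (normr_ge0 _); lra.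
Qed.

(** The witness is [regen], chosen before [p0]; the decay can fail only on [never]. *)
Lemma coupling_time (R : realType) (T : set R) (hT : is_time_set T)
    (X : completeNormedModType R) (hX : separable X)
    d (Omega : measurableType d)
    (E : markov_family T (borel X * borel X)%type Omega)
    (B : set X) (g : R -> R) (p C : R) :
  closed B -> weight g -> 1 < p -> recurrence E B g p ->
  polynomial_squeezing E B g p C ->
  (T = setT -> continuous_time_regular E B p C) ->
  exists l : Omega -> R, [/\ measurable_fun setT l,
    forall w, time_plus T (l w),
    forall x, {ae mf_law E x, forall w t, time_plus T t -> l w <= t ->
          pair_dist E t w <= C * (t - l w + 1) `^ (- p)} &
    forall p0, 0 < p0 -> p0 < p -> exists2 A, 0 < A & forall x : X * X,
      (\int[mf_law E x]_w ((l w) `^ p0)%:E <= (A * pair_weight g x)%:E)%E].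
Proof.
move=> cB wg p1 rec [d1 [c [K [q [d10 c0 K0 /andP[q1 _] sq]]]]] hreg.
have p0 : 0 < p by lra.
have rtau := tauB_regular hT cB hreg.
have rsg := sigma_regular hT hX hreg.
(* The cut at 1 / 2 places the ratio [1 - de] strictly between 0 and 1. *)
pose de := Num.min d1 (1 / 2).
have de0 : 0 < de by rewrite lt_min d10 /=; lra.
have de1 : de < 1 by rewrite gt_min; apply/orP; right; lra.
pose G (x : (borel X * borel X)%type) := pair_weight g (x : X * X).
have mG : measurable_fun setT G by exact: measurable_pair_weight.
have G1 x : 1 <= G x by exact: pair_weight_ge1.
pose BB : set (borel X * borel X)%type := B `*` B.
have tBB w : (tauB E B w < +oo)%E -> BB (mf_proc E (fine (tauB E B w)) w).
  exact: (proc_tauB hT cB hreg).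
have sgi x : BB x -> (de%:E <= mf_law E x [set w | sigma E C p w = +oo])%E.
  move=> /sq[h _ _]; apply: le_trans h.
  by rewrite lee_fin /de ge_min lexx.
have sgm x : BB x -> (\int[mf_law E x]_(w in [set w | (sigma E C p w < +oo)%E])
    (sigma E C p w `^ p) <= c%:E)%E by move=> /sq[].
have sgw x : BB x -> (\int[mf_law E x]_(w in [set w | (sigma E C p w < +oo)%E])
    (G (mf_proc E (fine (sigma E C p w)) w))%:E <= K%:E)%E.
  (* The hypothesis bounds the power [q] of the weight. As the weight and [q] are at least 1, the
     weight itself is smaller. *)
  move=> /sq[_ _]; apply: le_trans.
  have mGp : measurable_fun setT (fun w => G (mf_proc E (fine (sigma E C p w)) w)).
    have -> : (fun w => G (mf_proc E (fine (sigma E C p w)) w)) =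
        G \o (mf_proc E 0 \o shift_at E (sigma E C p)).
      by apply/funext => w /=; rewrite proc0_shift_at //; have [] := rsg.
    apply: measurableT_comp => //; apply: measurableT_comp.
      by apply: proc_measurable; exact: time_plus0.
    by have [] := rsg.
  apply: ge0_le_integral.
  - exact: regular_fin_measurable rsg.
  - by move=> w _; rewrite lee_fin (le_trans _ (G1 _)).
  - exact/measurable_funTS/measurable_EFinP.
  - apply/measurable_funTS/measurable_EFinP.
    exact: measurableT_comp (measurable_powR _) mGp.
  - by move=> w _; rewrite lee_fin; apply: le1r_powR => //; exact: G1.
exists (regen E (tauB E B) (sigma E C p)); split.
- exact: regen_measurable.
- by move=> w; exact: regen_time.
- move=> x; exists (never E (tauB E B) (sigma E C p)); split.
  + exact: never_measurable.
  + exact: (never_null hT rtau rsg mG G1 p0 de0 de1 (ltW K0) rec tBB sgi sgw x).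
  move=> w; apply: contra_notP => nw t tT lt.
  have := regen_spec hT rtau rsg nw.
  set l := regen _ _ _ _ in lt *.
  have lT : time_plus T l by exact: regen_time.
  move=> sinf; rewrite leNgt; apply/negP => dist.
  have tlT : time_plus T (t - l).
    split; last by rewrite subr_ge0.
    have [[Tt _] [Tl _]] := (tT, lT); case: hT Tt Tl => -> //.
    by move=> [i _ <-] [j _ <-]; exists (i - j) => //; rewrite rmorphB.
  (* A violation at time [t] would be a violation at time [t - l] for the trajectory restarted at
     [l], whose [sigma] is infinite. *)
  suff : (sigma E C p (mf_shift E l w) <= (t - l)%:E)%E by rewrite sinf leye_eq.
  apply: first_time_le => //.
  by rewrite /pair_dist mf_proc_shift // subrK ltW.
- move=> r r0 rp.
  exact: (regen_moment hT rtau rsg mG G1 p0 de0 de1 (ltW c0) (ltW K0) rec tBB sgi sgm sgw r0 rp).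
Qed.

Lemma powRN_anti (R : realType) (a b r : R) : 0 < a -> a <= b -> 0 <= r ->
  b `^ (- r) <= a `^ (- r).
Proof.
move=> a0 ab r0; have b0 : 0 < b by exact: lt_le_trans ab.
rewrite !powRN lef_pV2 ?posrE ?powR_gt0 //.
by apply: ge0_ler_powR => //; rewrite nnegrE ltW.
Qed.

(* Half of the time horizon is allotted to reaching [l]. *)
Lemma decay_split (R : realType) (t l C p p0 K D dist : R) :
  0 <= t -> 0 <= l -> 0 < C -> 0 < p0 -> p0 < p -> 0 <= K ->
  D <= 2 * K -> D <= K * dist -> (l <= t -> dist <= C * (t - l + 1) `^ (- p)) ->
  D <= K * (2 `^ p0 * (t + 1) `^ (- p0) * (C + 2 * 2 `^ p0 * (1 + l `^ p0))).
Proof.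
move=> t0 l0 C0 p00 p0p K0 D2 Ddist hdist.
set h := 2 `^ p0 * (t + 1) `^ (- p0).
have h0 : 0 <= h by rewrite mulr_ge0 ?powR_ge0.
have hE : ((t + 1) / 2) `^ (- p0) = h.
  rewrite powRM ?invr_ge0 //; last lra.
  by rewrite mulrC /h -powR_inv1 // -powRrM mulN1r opprK.
have e0 : 0 <= 2 * 2 `^ p0 * (1 + l `^ p0).
  by rewrite !mulr_ge0 ?addr_ge0 ?powR_ge0.
(* If [l] is at most [t / 2], then [t - l + 1] is at least 1, which allows the exponent [p] to be
   lowered to [p0], and at least [(t + 1) / 2], whence the factor [h]. *)
have [lt|tl] := leP l (t / 2).
  apply: le_trans Ddist _; apply: ler_wpM2l => //.
  apply: le_trans (hdist _) _; first lra.
  apply: le_trans (_ : h * C <= _); last by apply: ler_wpM2l => //; lra.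
  rewrite mulrC; apply: ler_wpM2r; first exact: ltW.
  apply: le_trans (_ : (t - l + 1) `^ (- p0) <= _).
    by apply: ler_powR; lra.
  by rewrite -hE; apply: powRN_anti; lra.
(* Otherwise [l + 1] is at least [(t + 1) / 2], so that [h] times the power [p0] of [l + 1] is at
   least 1 and the trivial bound [2 * K] suffices. *)
apply: le_trans D2 _; rewrite mulrC; apply: ler_wpM2l => //.
apply: le_trans (_ : h * (2 * (l + 1) `^ p0) <= _); last first.
  apply: ler_wpM2l => //; rewrite -mulrA.
  have := powR_add_le p00 l0 ler01; rewrite powR1 [l `^ _ + _]addrC.
  by move: (2 `^ p0 * _) ((l + 1) `^ p0) => u v; lra.
rewrite mulrCA ler_peMr //.
have y0 : 0 < (t + 1) / 2 by rewrite divr_gt0 //; lra.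
rewrite -hE powRN mulrC -powR_inv1 ?powR_ge0 //.
rewrite powR_inv1 ?powR_ge0 // ler_pdivlMr ?powR_gt0 // mul1r.
by apply: ge0_ler_powR; rewrite ?nnegrE; lra.
Qed.

(** * Contraction of the semigroup by coupling *)

Section Mixing.
Context (R : realType) (T : set R) (hT : is_time_set T).
Context (X : completeNormedModType R).
Context d (Omega : measurableType d) d' (Omega' : measurableType d').
Variable M : markov_family T (borel X) Omega.
Variable E : markov_family T (borel X * borel X)%type Omega'.
Hypothesis ext : is_extension M E.

Lemma extension_Pt (f : X -> R) t (x : X * X) : blip f -> time_plus T t ->
  \int[mf_law E x]_w f (mf_proc E t w).1 = Pt M t f x.1 /\
  \int[mf_law E x]_w f (mf_proc E t w).2 = Pt M t f x.2.
Proof.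
move=> bf tT; have mf := blip_measurable bf; have [K [fK _]] := bf.
have half (phi : Omega' -> borel X) (u : X) : measurable_fun setT phi ->
    (forall A : set (borel X), measurable A ->
      mf_law E x (phi @^-1` A) = transition M t u A) ->
    \int[mf_law E x]_w f (phi w) = Pt M t f u.
  move=> mphi phiE.
  have [Q1 [Q1E Q1f]] := pushforward_probability (kernel_at (mf_law E) x) mphi.
  have [Q2 [Q2E Q2f]] := transition_probability M u tT.
  rewrite -(Q2f f K mf fK); apply: etrans (esym (Q1f f K mf fK)) _.
  congr fine; apply: eq_measure_integral => A mA _.
  exact: etrans (Q1E A) (etrans (phiE A mA) (esym (Q2E A))).
have mE := proc_measurable E tT.
have cyl (A : set (borel X)) : measurable A -> path_sigma T [set w | A (w t)].
  by move=> mA; apply: sub_sigma_algebra; exists t, A.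
split; apply: half.
- exact: measurableT_comp measurable_fst mE.
- by move=> A /cyl/(ext x)[].
- exact: measurableT_comp measurable_snd mE.
- by move=> A /cyl/(ext x)[].
Qed.

Variables (g : R -> R) (p p0 C A : R) (l : Omega' -> R).
Hypotheses (wg : weight g) (C0 : 0 < C) (p00 : 0 < p0) (p0p : p0 < p) (A0 : 0 < A).
Hypothesis ml : measurable_fun setT l.
Hypothesis lT : forall w, time_plus T (l w).
Hypothesis decay : forall x, {ae mf_law E x, forall w t, time_plus T t -> l w <= t ->
  pair_dist E t w <= C * (t - l w + 1) `^ (- p)}.
Hypothesis l_moment : forall x : X * X,
  (\int[mf_law E x]_w ((l w) `^ p0)%:E <= (A * pair_weight g x)%:E)%E.

(** The result of integrating [decay_split]: the outer 2^p0 comes from halving the time horizon, and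
    [A] from the moment of [l]. The terms without the weight are multiplied by it, as it is at least
    1. *)
Definition mixing_cst : R := 2 `^ p0 * (C + 2 * 2 `^ p0 * (1 + A)).

Lemma mixing_cst_gt0 : 0 < mixing_cst.
Proof. by rewrite mulr_gt0 ?powR_gt0 // addr_gt0 // !mulr_gt0 ?powR_gt0 ?addr_gt0. Qed.

Lemma Pt_contract (f : X -> R) K t (x : X * X) : blip_by K f -> time_plus T t ->
  `|Pt M t f x.1 - Pt M t f x.2| <=
    K * (mixing_cst * pair_weight g x * (t + 1) `^ (- p0)).
Proof.
move=> fK tT; have K0 := blip_by_ge0 fK.
have bf : blip f by exists K.
have [bK lK] := fK; have mf := blip_measurable bf.
have [<- <-] := extension_Pt x bf tT.
have mE := proc_measurable E tT.
pose F1 w := f (mf_proc E t w).1; pose F2 w := f (mf_proc E t w).2.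
have mF1 : measurable_fun setT F1.
  by apply: measurableT_comp => //; exact: measurableT_comp measurable_fst mE.
have mF2 : measurable_fun setT F2.
  by apply: measurableT_comp => //; exact: measurableT_comp measurable_snd mE.
pose P := kernel_at (mf_law E) x.
have i1 : P.-integrable setT (EFin \o F1).
  by apply: (bounded_integrable P (K := K)) => // w; exact: bK.
have i2 : P.-integrable setT (EFin \o F2).
  by apply: (bounded_integrable P (K := K)) => // w; exact: bK.
have mF12 : measurable_fun setT (fun w => F1 w - F2 w) by exact: measurable_funB.
have F12K w : `|F1 w - F2 w| <= 2 * K.
  have := bK (mf_proc E t w).1; have := bK (mf_proc E t w).2.
  by have := ler_normB (F1 w) (F2 w); rewrite /F1 /F2; lra.
have i12 : P.-integrable setT (EFin \o (fun w => F1 w - F2 w)).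
  by apply: (bounded_integrable P (K := 2 * K)).
have := RintegralB measurableT i1 i2; rewrite /F1 /F2 => <-.
apply: le_trans (le_normr_Rintegral measurableT i12) _.
pose h := 2 `^ p0 * (t + 1) `^ (- p0).
have h0 : 0 <= h by rewrite mulr_ge0 ?powR_ge0.
pose c1 := K * h * (C + 2 * 2 `^ p0); pose c2 := K * h * (2 * 2 `^ p0).
have c10 : 0 <= c1 by rewrite !mulr_ge0 ?addr_ge0 ?mulr_ge0 ?powR_ge0 // ltW.
have c20 : 0 <= c2 by rewrite !mulr_ge0 ?powR_ge0.
have mlp : measurable_fun setT (fun w => l w `^ p0).
  exact: measurableT_comp (measurable_powR _) ml.
have mn : measurable_fun setT (fun w => `|F1 w - F2 w|) by exact: measurableT_comp.
have fin : (\int[P]_w (`|F1 w - F2 w|)%:E)%E \is a fin_num.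
  apply: integrable_fin_num => //.
  by apply: (bounded_integrable P (K := 2 * K)) => // w; rewrite normr_id.
rewrite -lee_fin -[X in (X <= _)%E]/((fine (\int[P]_w (`|F1 w - F2 w|)%:E))%:E)%E.
rewrite fineK //.
apply: le_trans (_ : (\int[P]_w (c1%:E + c2%:E * (l w `^ p0)%:E) <= _)%E).
  apply: ae_ge0_le_integral => //.
  - exact/measurable_EFinP.
  - by move=> w _; rewrite -EFinM -EFinD lee_fin addr_ge0 // mulr_ge0 // powR_ge0.
  - apply/measurable_EFinP; apply: measurable_funD; first exact: measurable_cst.
    by apply: measurable_funM => //; exact: measurable_cst.
  have := decay x; apply: filterS => w hw _.
  rewrite -EFinM -EFinD lee_fin.
  have [_ t0] := tT; have [_ l0] := lT w.
  apply: le_trans (decay_split t0 l0 C0 p00 p0p K0 (F12K w) (lK _ _) (hw t tT)) _.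
  rewrite -/h /c1 /c2 le_eqVlt; apply/orP; left; apply/eqP; ring.
rewrite ge0_integralD //; last 2 first.
- by move=> w _; rewrite -EFinM lee_fin mulr_ge0 // powR_ge0.
- apply/measurable_EFinP.
  by apply: measurable_funM => //; exact: measurable_cst.
have -> : (\int[P]_w c1%:E = c1%:E)%E.
  rewrite integral_cst //; apply: etrans (mule1 _); congr (_ * _)%E.
  exact: probability_setT.
rewrite ge0_integralZl //; last 2 first.
- exact/measurable_EFinP.
- by move=> w _; rewrite lee_fin powR_ge0.
apply: le_trans (_ : (c1%:E + c2%:E * (A * pair_weight g x)%:E <= _)%E).
  by rewrite leeD2l // lee_wpmul2l ?lee_fin //; exact: l_moment.
rewrite -EFinM -EFinD lee_fin.
have G1 := pair_weight_ge1 x wg.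
have -> : K * (mixing_cst * pair_weight g x * (t + 1) `^ (- p0)) =
    c1 * pair_weight g x + c2 * (A * pair_weight g x).
  by rewrite /mixing_cst /c1 /c2 /h; ring.
by rewrite lerD2r ler_peMr.
Qed.

End Mixing.

(** * Ergodicity *)

Lemma cvg_powRN (R : realType) (r : R) : 0 < r ->
  (n%:R + 1) `^ (- r) @[n --> \oo] --> (0 : R).
Proof.
move=> r0; apply/cvgrPdist_le => e e0.
pose N := Num.bound (e^-1 `^ r^-1).
have eN : e^-1 `^ r^-1 < N%:R by apply: archi_boundP; exact: powR_ge0.
exists N => // n /= Nn; rewrite sub0r normrN ger0_norm ?powR_ge0 //.
have ep : 0 < e^-1 `^ r^-1 by rewrite powR_gt0 // invr_gt0.
apply: le_trans (_ : (e^-1 `^ r^-1) `^ (- r) <= _).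
  apply: powRN_anti => //; last exact: ltW.
  apply: le_trans (ltW eN) _; apply: le_trans (_ : n%:R <= _).
    by rewrite ler_nat.
  by rewrite lerDl.
rewrite -powRrM mulrN mulVf ?lt0r_neq0 // powR_inv1 ?invrK //.
by rewrite invr_ge0 ltW.
Qed.

Lemma lip_norm_blip (R : realType) (X : completeNormedModType R) (f : X -> R) :
  (lip_norm f <= 1)%E -> blip_by 1 f.
Proof.
rewrite /lip_norm; set s1 := ereal_sup _; set s2 := ereal_sup _ => s12.
have s1f u : (`|f u|%:E <= s1)%E by apply: ereal_sup_ubound; exists u.
have s2f u v : ((`|f u - f v| / `|u - v|)%:E <= s2)%E.
  by apply: ereal_sup_ubound; exists (u, v).
have s10 : (0 <= s1)%E by apply: le_trans (s1f 0); rewrite lee_fin.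
have s20 : (0 <= s2)%E.
  by apply: le_trans (s2f 0 0); rewrite lee_fin divr_ge0.
split=> [u|u v]; rewrite -lee_fin.
  by apply: le_trans (s1f u) _; apply: le_trans s12; exact: leeDl.
have [->|uv] := eqVneq u v; first by rewrite !subrr !normr0 mulr0.
have : ((`|f u - f v| / `|u - v|)%:E <= 1)%E.
  by apply: le_trans (s2f u v) _; apply: le_trans s12; exact: leeDr.
by rewrite !lee_fin ler_pdivrMr // normr_gt0 subr_eq0.
Qed.

Section Ergodicity.
Context (R : realType) (T : set R) (hT : is_time_set T).
Context (X : completeNormedModType R) (hX : separable X).
Context d (Omega : measurableType d) (M : markov_family T (borel X) Omega).
Variables (g gt : R -> R) (p0 A : R).
Hypotheses (hM : feller M) (wg : weight g) (p00 : 0 < p0) (A0 : 0 < A).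
Hypothesis contract : forall (f : X -> R) K t (x : X * X),
  blip_by K f -> time_plus T t ->
  `|Pt M t f x.1 - Pt M t f x.2| <=
    K * (A * pair_weight g x * (t + 1) `^ (- p0)).
Hypothesis g_moment : forall t (u : X), time_plus T t ->
  (\int[mf_law M u]_w (g `|mf_proc M t w : X|)%:E <= (gt `|u|)%:E)%E.

(** By [chapman], the contraction at the pair formed by [u] and the state at time [s] is integrated
    over the process issued from 0. The moment bound at 0 is uniform in [s], which is the origin of
    [gt 0] in the rate. *)
Lemma Pt_contract_later (f : X -> R) K t s u :
  blip_by K f -> time_plus T t -> time_plus T s ->
  `|Pt M t f u - Pt M (t + s) f 0| <=
    K * (A * (g `|u| + gt 0) * (t + 1) `^ (- p0)).
Proof.
move=> fK tT sT; have K0 := blip_by_ge0 fK; have [bK _] := fK.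
have bf : blip f by exists K.
have mf := blip_measurable bf.
rewrite (chapman hT M mf bK) //.
pose P := kernel_at (mf_law M) (0 : X).
pose F w := Pt M t f (mf_proc M s w).
have mps := proc_measurable M sT.
have mPt : measurable_fun setT (Pt M t f) by exact (Pt_measurable M mf bK tT).
have mF : measurable_fun setT F by exact: measurableT_comp mPt mps.
have FK w : `|F w| <= K by exact: (Pt_bounded M mf bK).
have iF : P.-integrable setT (EFin \o F) by exact: (bounded_integrable P mF FK).
pose a := Pt M t f u.
have mc : measurable_fun setT (fun _ : Omega => a) by exact: measurable_cst.
have ia : P.-integrable setT (EFin \o (fun=> a)).
  by apply: (bounded_integrable P (K := `|a|)).
have aK : `|a| <= K by exact: (Pt_bounded M mf bK).
have maF : measurable_fun setT (fun w => a - F w) by exact: measurable_funB.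
have aFK w : `|a - F w| <= 2 * K.
  by have := FK w; have := ler_normB a (F w); lra.
have iaF : P.-integrable setT (EFin \o (fun w => a - F w)).
  exact: (bounded_integrable P maF aFK).
have -> : a - \int[mf_law M 0]_w F w = \int[P]_w (a - F w).
  by rewrite RintegralB // Rintegral1.
apply: le_trans (le_normr_Rintegral measurableT iaF) _.
have mn : measurable_fun setT (fun w => `|a - F w|) by exact: measurableT_comp.
have fin : (\int[P]_w (`|a - F w|)%:E)%E \is a fin_num.
  apply: integrable_fin_num => //.
  by apply: (bounded_integrable P (K := 2 * K)) => // w; rewrite normr_id.
rewrite -lee_fin -[X in (X <= _)%E]/((fine (\int[P]_w (`|a - F w|)%:E))%:E)%E.
rewrite fineK //.
pose c := K * (A * (t + 1) `^ (- p0)).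
have c0 : 0 <= c by rewrite !mulr_ge0 ?powR_ge0 // ltW.
have g0 (v : X) : 0 <= g `|v| by apply: le_trans ler01 _; apply: wg.2.
have mg : measurable_fun setT (fun w => g `|mf_proc M s w : X|).
  exact: measurableT_comp (measurable_weight_norm wg) mps.
apply: le_trans (_ : (\int[P]_w ((c * g `|u|)%:E + c%:E * (g `|mf_proc M s w : X|)%:E)
    <= _)%E).
  apply: ge0_le_integral => //.
  - exact/measurable_EFinP.
  - apply/measurable_EFinP; apply: measurable_funD; first exact: measurable_cst.
    by apply: measurable_funM => //; exact: measurable_cst.
  move=> w _; rewrite -EFinM -EFinD lee_fin.
  apply: le_trans (contract (u, mf_proc M s w) fK tT) _.
  by rewrite /pair_weight /c /= le_eqVlt; apply/orP; left; apply/eqP; ring.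
rewrite ge0_integralD //; last 3 first.
- by move=> w _; rewrite lee_fin mulr_ge0.
- by move=> w _; rewrite -EFinM lee_fin mulr_ge0.
- apply/measurable_EFinP.
  by apply: measurable_funM => //; exact: measurable_cst.
have -> : (\int[P]_w (c * g `|u|)%:E = (c * g `|u|)%:E)%E.
  rewrite integral_cst //; apply: etrans (mule1 _); congr (_ * _)%E.
  exact: probability_setT.
rewrite ge0_integralZl //; last 2 first.
- exact/measurable_EFinP.
- by move=> w _; rewrite lee_fin.
apply: le_trans (_ : ((c * g `|u|)%:E + c%:E * (gt 0)%:E <= _)%E).
  rewrite leeD2l // lee_wpmul2l ?lee_fin //.
  by have := g_moment 0 sT; rewrite normr0.
by rewrite -EFinM -EFinD lee_fin le_eqVlt; apply/orP; left; apply/eqP; rewrite /c; ring.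
Qed.

Let nT := time_plus_nat hT.

Lemma transition_kernel t : time_plus T t -> exists k : X -> probability (borel X) R,
  [/\ forall u B, k u B = transition M t u B,
      forall B, measurable B -> measurable_fun setT (fun u : borel X => k u B) &
      forall u (f : borel X -> R) K, measurable_fun setT f ->
        (forall z, `|f z| <= K) -> \int[k u]_z f z = Pt M t f u].
Proof.
move=> tT; pose k u := projT1 (cid (transition_probability M u tT)).
have kP u := projT2 (cid (transition_probability M u tT)).
exists k; split=> [u B|B mB|u].
- by have [] := kP u.
- rewrite (_ : (fun u => _) = (fun u => mf_law M u (mf_proc M t @^-1` B))).
    apply: measurable_kernel.
    by rewrite -[X in measurable X]setTI; exact: proc_measurable.
  by apply/funext => u; have [-> _] := kP u.
- by have [] := kP u.
Qed.

Let rate (n : nat) : R := A * (g `|0 : X| + gt 0) * (n%:R + 1) `^ (- p0).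

Let rate0 : rate n @[n --> \oo] --> (0 : R).
Proof.
rewrite -(mulr0 (A * (g `|0 : X| + gt 0))).
by apply: cvgMr; exact: cvg_powRN.
Qed.

(** The laws issued from 0 at integer times are Cauchy with rate [rate]. A fixed delay [t] does not
    change the limit, because [Pt_contract_later] at [u = 0] compares the times [n] and [n + t]. *)
Lemma limit_law : exists mu : probability (borel X) R,
  forall (f : X -> R) t, blip f -> time_plus T t ->
    Pt M (t + n%:R) f 0 @[n --> \oo] --> \int[mu]_x f x.
Proof.
have [k kP] : exists k : nat -> probability (borel X) R, forall n (f : X -> R),
    blip f -> \int[k n]_x f x = Pt M n%:R f 0.
  pose k n := projT1 (cid (transition_probability M (0 : X) (nT n))).
  exists k => n f bf.
  have [_ kf] := projT2 (cid (transition_probability M (0 : X) (nT n))).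
  by have [K [fK _]] := bf; apply: kf fK; exact: blip_measurable.
have [|mu muP] := dual_lipschitz_complete hX (P := k) rate0.
  move=> n m f nm f1; have bf : blip f by exists 1.
  rewrite !kP // -(subnKC nm) natrD.
  by apply: le_trans (Pt_contract_later 0 f1 (nT n) (nT _)) _; rewrite mul1r.
exists mu => f t bf tT; have [K fK] := bf.
have Pn : Pt M n%:R f 0 @[n --> \oo] --> \int[mu]_x f x.
  by have := muP f bf; under eq_fun do rewrite kP //.
have Kr : K * rate n @[n --> \oo] --> 0.
  by rewrite -(mulr0 K); apply: cvgMr; exact: rate0.
apply/cvgrPdist_le => e e0; have e20 : 0 < e / 2 by rewrite divr_gt0.
have /cvgrPdist_le/(_ _ e20) h1 := Pn.
have /cvgrPdist_le/(_ _ e20) h2 := Kr.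
apply: filterS2 h1 h2 => n h1 h2.
have h3 := Pt_contract_later 0 fK (nT n) tT.
rewrite [t + _]addrC -(subrKA (Pt M n%:R f 0)).
apply: le_trans (ler_normD _ _) _; rewrite (splitr e); apply: lerD => //.
apply: le_trans h3 _; apply: le_trans h2.
by rewrite sub0r normrN; exact: ler_norm.
Qed.

Lemma Pt_limit (mu : probability (borel X) R) : (forall (f : X -> R) t, blip f -> time_plus T t ->
    Pt M (t + n%:R) f 0 @[n --> \oo] --> \int[mu]_x f x) ->
  forall (f : X -> R) K t u, blip_by K f -> time_plus T t ->
  `|Pt M t f u - \int[mu]_x f x| <= K * (A * (g `|u| + gt 0) * (t + 1) `^ (- p0)).
Proof.
move=> muP f K t u fK tT; have bf : blip f by exists K.
have cv : `|Pt M t f u - Pt M (t + n%:R) f 0| @[n --> \oo] -->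
    `|Pt M t f u - \int[mu]_x f x|.
  by apply: cvg_norm; apply: cvgB; [exact: cvg_cst|exact: muP].
by apply: (cvgr_to_le cv); apply: nearW => n; exact: Pt_contract_later.
Qed.

Theorem ergodic : exists mu : probability (borel X) R,
  [/\ stationary M mu,
      forall nu : probability (borel X) R, stationary M nu ->
        forall B : set (borel X), measurable B -> nu B = mu B &
      forall t (u : X), time_plus T t ->
        (dual_lip_dist (transition M t u) mu
           <= (A * (g `|u| + gt 0) * (t + 1) `^ (- p0))%:E)%E].
Proof.
have [mu muP] := limit_law; have lim := Pt_limit muP.
have blip01 (f : X -> R) : blip f -> (forall x, 0 <= f x <= 1) ->
    forall x, `|f x| <= 1.
  by move=> _ f01 x; have /andP[? ?] := f01 x; rewrite ger0_norm.
have mixE (nu : probability (borel X) R) t : time_plus T t ->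
    exists Q : probability (borel X) R,
      (forall B, Q B = \int[nu]_x transition M t x B)%E /\
      forall f : X -> R, blip f -> (forall x, 0 <= f x <= 1) ->
        \int[Q]_x f x = \int[nu]_x Pt M t f x.
  move=> tT; have [k [kE mk kf]] := transition_kernel tT.
  have [Q [QE Qh]] := mixture_probability nu mk.
  exists Q; split=> [B|f bf f01].
    by rewrite QE; apply: eq_integral => x _; rewrite kE.
  have mf := blip_measurable bf.
  rewrite /Rintegral Qh; last 2 first.
  - by move=> z; rewrite lee_fin; have /andP[] := f01 z.
  - exact/measurable_EFinP.
  congr fine; apply: eq_integral => x _.
  by rewrite -(kf x f 1 mf (blip01 f bf f01)) blip_integral_fin.
exists mu; split.
- move=> t B tT mB; have [Q [QE Qf]] := mixE mu t tT.
  rewrite -QE; apply: probability_blip_unique mB => f bf f01.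
  rewrite Qf //; have mf := blip_measurable bf.
  have f1 := blip01 f bf f01.
  (* Here the Feller property enters: it makes [Pt M t f] an admissible test function for
     [blip_cvg_continuous]. *)
  have cPt : continuous (Pt M t f : X -> R).
    have bb : exists a : R, forall v, `|f v| <= a by exists 1.
    have := hM tT (blip_continuous bf) bb.
    rewrite (_ : (fun x : X => _) = (Pt M t f : X -> R)) //.
    by apply/funext => x; rewrite (Pt_integral M x tT mf f1).
  have Pt01 x : 0 <= Pt M t f x <= 1.
    have := Pt_bounded M mf f1 x tT.
    rewrite ler_norml => /andP[_ ->]; rewrite andbT.
    by apply: Rintegral_ge0 => w _; have /andP[] := f01 (mf_proc M t w).
  pose k n := projT1 (cid (transition_probability M (0 : X) (nT n))).
  have kP n := (projT2 (cid (transition_probability M (0 : X) (nT n)))).2.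
  have cvk h : blip h -> \int[k n]_x h x @[n --> \oo] --> \int[mu]_x h x.
    move=> bh; have := muP h 0 bh (time_plus0 hT).
    have [K [hK _]] := bh.
    under eq_fun do rewrite add0r -(kP _ h K (blip_measurable bh) hK).
    exact.
  (* By [chapman], the integrals of [Pt M t f] against the laws at time [n] are
     [Pt M (t + n%:R) f 0], which also tends to the integral of [f] under [mu]. *)
  apply: (cvg_unique _ (blip_cvg_continuous cvk cPt Pt01)) => //.
  have := muP f t bf tT.
  under eq_fun => n.
    rewrite (chapman hT M mf f1) //.
    have -> : \int[mf_law M 0]_w Pt M t f (mf_proc M n%:R w) =
        \int[k n]_x Pt M t f x.
      rewrite (kP n _ 1) //; first exact (Pt_measurable M mf f1 tT).
      by move=> z; exact: (Pt_bounded M mf f1).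
    over.
  exact.
- move=> nu snu B mB; apply: probability_blip_unique mB => f bf f01.
  have mf := blip_measurable bf; have f1 := blip01 f bf f01.
  have nuE n : \int[nu]_x f x = \int[nu]_x Pt M n%:R f x.
    have [Q [QE Qf]] := mixE nu n%:R (nT n).
    rewrite -Qf //; congr fine; apply: eq_measure_integral => C mC _.
    by apply/esym; apply: etrans (QE C) _; exact: snu.
  (* The left side does not depend on [n] by stationarity of [nu], and the integrands, bounded by 1,
     tend pointwise to a constant. The rate depends on the starting point, so dominated convergence
     is used rather than the rate itself. *)
  have cv : \int[nu]_x Pt M n%:R f x @[n --> \oo] --> \int[nu]_x \int[mu]_y f y.
    apply: (@bounded_cvg_Rintegral _ _ _ nu (fun n => Pt M n%:R f)
      (fun=> \int[mu]_y f y) 1).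
    - by move=> n; exact (Pt_measurable M mf f1 (nT n)).
    - by move=> n x; exact: (Pt_bounded M mf f1).
    - move=> u; have [K fK] := bf.
      apply/cvgrPdist_le => e e0.
      have cK : K * (A * (g `|u| + gt 0) * (n%:R + 1) `^ (- p0)) @[n --> \oo] --> 0.
        rewrite -[X in _ --> X](mulr0 K); apply: cvgMr.
        by rewrite -[X in _ --> X](mulr0 (A * (g `|u| + gt 0))); apply: cvgMr; exact: cvg_powRN.
      have /cvgrPdist_le/(_ _ e0) := cK; apply: filterS => n h.
      rewrite distrC; apply: le_trans (lim f K _ u fK (nT n)) _; apply: le_trans h.
      by rewrite sub0r normrN; exact: ler_norm.
  rewrite Rintegral1 in cv.
  apply: (cvg_unique _ _ cv) => //.
  have -> : (fun n => \int[nu]_x Pt M n%:R f x) = (fun=> \int[nu]_x f x).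
    by apply/funext => n; rewrite -nuE.
  exact: cvg_cst.
- move=> t u tT; apply: ge_ereal_sup => _ [f /lip_norm_blip f1 <-].
  have bf : blip f by exists 1.
  rewrite (Pt_integral M u tT (blip_measurable bf) f1.1) blip_integral_fin //.
  by rewrite -EFinB /= lee_fin; have := lim f 1 t u f1 tT; rewrite mul1r.
Qed.

End Ergodicity.

Theorem theorem1p2 (R : realType) (T : set R) (hT : is_time_set T)
    (X : completeNormedModType R) (hX : separable X)
    (d d' : measure_display)
    (Omega : measurableType d) (Omega' : measurableType d')
    (M : markov_family T (borel X) Omega)
    (E : markov_family T (borel X * borel X)%type Omega')
    (B : set X) (g : R -> R) (p C : R)
    (hM : feller M)
    (hE : mixing_extension M E B g p C)
    (hreg : T = setT -> continuous_time_regular E B p C) :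
  exists l : Omega' -> R,
  [/\ measurable_fun setT l,
      forall w, time_plus T (l w) &
  forall p0 : R, 0 < p0 -> p0 < p ->
  exists C1 : R,
  [/\ 0 < C1,
      forall x : X * X,
        {ae mf_law E x, forall w, forall t : R, time_plus T t -> l w <= t ->
          pair_dist E t w <= C1 * (t - l w + 1) `^ (- p)},
      forall x : X * X,
        (\int[mf_law E x]_w ((l w) `^ p0)%:E
           <= (C1 * (pair_weight g x + 1))%:E)%E &
      forall gt : R -> R, weight gt ->
        (forall (t : R) (u : X), time_plus T t ->
          (\int[mf_law M u]_w (g `|mf_proc M t w : X|)%:E
             <= (gt `|u|)%:E)%E) ->
        exists mu : probability (borel X) R,
        [/\ stationary M mu,
            forall nu : probability (borel X) R, stationary M nu ->
              forall A : set (borel X), measurable A -> nu A = mu A &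
            forall (t : R) (u : X), time_plus T t ->
              (dual_lip_dist (transition M t u) mu
                 <= (3 * C1 * (g `|u| + gt 0) * (t + 1) `^ (- p0))%:E)%E]]].

Proof.
have [ext [cB wg] [p1 C0] rec sq] := hE.
have [l [ml lT decay lmom]] := coupling_time hT hX cB wg p1 rec sq hreg.
exists l; split=> // p0 p00 p0p; have [A A0 lA] := lmom p0 p00 p0p.
have A'0 := mixing_cst_gt0 p0 C0 A0.
have contract := Pt_contract ext wg C0 p00 p0p ml lT decay lA.
(* One constant has to serve three bounds: [C] for the decay of the distance, [A] for the moment of
   [l], and [A'] for the convergence to [mu]. *)
pose A' := mixing_cst p0 C A; exists (C + A + A'); split.
- by rewrite !addr_gt0.
- move=> x; apply: filterS (decay x) => w h t tT lt.
  apply: le_trans (h t tT lt) _; apply: ler_wpM2r; first exact: powR_ge0.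
  by rewrite -addrA lerDl addr_ge0 // ltW.
- move=> x; apply: le_trans (lA x) _; rewrite lee_fin.
  have G1 := pair_weight_ge1 x wg.
  by apply: ler_pM; [exact: ltW|lra| |lra]; move: A'0; rewrite -/A'; lra.
move=> gt wgt gtm.
have [mu [smu umu dmu]] := ergodic hT hX hM wg p00 A'0 contract gtm.
exists mu; split=> // t u tT; apply: le_trans (dmu t u tT) _; rewrite lee_fin.
have g0 : 0 <= g `|u| by apply: le_trans ler01 _; apply: wg.2.
have gt0 : 0 <= gt 0 by apply: le_trans ler01 _; apply: wgt.2.
apply: ler_wpM2r; first exact: powR_ge0.
by apply: ler_wpM2r; [exact: addr_ge0|move: A'0; rewrite -/A'; lra].
Qed.
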